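(* Let $\mathcal{A}$ be an at most countable alphabet, $X=\{(x_0,x_1,\ldots): x_i\in\mathcal{A}\}$, and let $\theta:X\to X$, $\theta(x_0,x_1,\ldots)=(x_1,x_2,\ldots)$, be the full shift. Let $\mu$ be a $\theta$-invariant Borel probability measure on $X$ such that $\log\frac{d\mu}{d\mu\circ\theta}$ is Hölder continuous (in the sense made precise in the context). Let $\mathcal{G}=(\mathbf{V},\mathbf{E})$ be a graph, let $x\mapsto\kappa_x$ be a map from $X$ to the set of bijections of $\mathbf{V}$ which depends only on the first coordinate $x_0$ of $x$ and satisfies $(v,\kappa_x(v))\in\mathbf{E}$ for all $x\in X$, $v\in\mathbf{V}$, and let $T:X\times\mathbf{V}\to X\times\mathbf{V}$, $T(x,v)=(\theta(x),\kappa_x(v))$. Assume that $T$ is topologically transitive and has uniform loops. Then the following are equivalent. (1) The graph $\mathcal{G}$ is $\mu$-amenable. (2) The spectral radius of $\widehat{T}$, acting on $\mathcal{H}_\infty=\{f:X\times\mathbf{V}\to\mathbb{R} : \sum_{v\in\mathbf{V}}\|f(\cdot,v)\|_\infty^2<\infty\}$, is equal to $1$. (3) For each $\epsilon>0$ there exists a finite nonempty subset $A\subset\mathbf{V}$ such that $$\int |\widehat{T}(\mathbf{1}_{X\times A})-\mathbf{1}_{X\times A}|\,d(\mu\otimes m_{\mathbf{V}})\le \epsilon\cdot m_{\mathbf{V}}(A).$$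
   Context: A graph $\mathcal{G}=(\mathbf{V},\mathbf{E})$ is directed, with $\mathbf{V}$ an at most countable set and $\mathbf{E}\subset\mathbf{V}\times\mathbf{V}$; for $e=(u,v)\in \mathbf{E}$ write $s(e)=u$, $t(e)=v$. $m_{\mathbf{V}}$ is the counting measure on $\mathbf{V}$. Hölder condition: for a finite word $w$ of length $n$ let $[w]\subset X$ be the cylinder of sequences starting with $w$, $\tau_w:X\to[w]$, $\tau_w(x)=wx$, and $\varphi_w=\frac{d\mu\circ\tau_w}{d\mu}$; it is understood that cylinders have positive measure and that $0<\varphi_w<\infty$ a.e. The condition is that there exist $C>0$ and $r\in(0,1)$ such that $|\log\varphi_w(x)-\log\varphi_w(y)|\le C\,d_r(x,y)$ for all finite words $w$ and a.e. $x,y\in X$, where $d_r(x,y)=r^{\min\{i:x_i\ne y_i\}}$. The derivative $\frac{d\mu}{d\mu\circ\theta}$ is taken on regions of injectivity of $\theta$, i.e. $\frac{d\mu}{d\mu\circ\theta}(\tau_a x)=\varphi_a(x)$ for $a\in\mathcal{A}$. Topological transitivity of $T$: for all $a,b\in\mathcal{A}$ and $u,v\in\mathbf{V}$ there is $n\ge1$ with $(\mu\otimes m_{\mathbf{V}})\big(T^n([a]\times\{u\})\cap([b]\times\{v\})\big)>0$. Uniform loops: there is a finite set $\mathcal{J}\subset X$ such that $v\in\{\kappa_x(v):x\in\mathcal{J}\}$ for all $v\in\mathbf{V}$. $\mu$-amenability: put $p(u,v)=\mu(\{x\in X:\kappa_x(u)=v\})$ for $(u,v)\in\mathbf{E}$.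 For $\epsilon>0$ and $K\subset\mathbf{V}$ let $\partial^\epsilon K=\{v\in K:\exists e\in\mathbf{E}\text{ with } s(e)=v,\ t(e)\notin K,\ p(e)>\epsilon\}$. $\mathcal{G}$ is $\mu$-amenable if $\lim_{\epsilon\to0}\inf\{|\partial^\epsilon K|/|K|: K\subset\mathbf{V},\ 0<|K|<\infty\}=0$. The transfer operator $\widehat{T}$ is determined by $\int (f\circ T)\,g\,d(\mu\otimes m_{\mathbf{V}})=\int f\,\widehat{T}(g)\,d(\mu\otimes m_{\mathbf{V}})$ for $f\in L^\infty$, $g\in L^1$; it is given by $\widehat{T}(g)(x,v)=\sum_{T(y,w)=(x,v)}\frac{d\mu}{d\mu\circ\theta}(y)\,g(y,w)$, and this formula defines it on $\mathcal{H}_\infty$. The space $\mathcal{H}_\infty$ consists of (classes of) measurable functions, $\|\cdot\|_\infty$ is the $L^\infty(X,\mu)$-norm, and $\mathcal{H}_\infty$ is a Banach space with norm $\big(\sum_{v}\|f(\cdot,v)\|_\infty^2\big)^{1/2}$ on which $\widehat{T}$ is bounded; the spectral radius is $\lim_{k}\|\widehat{T}^k\|^{1/k}$. *)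

(* Defs.v *)
From HB Require Import structures.
From mathcomp Require Import all_boot all_order all_algebra finmap.
From mathcomp Require Import all_classical all_reals all_analysis.

Set Implicit Arguments.
Unset Strict Implicit.
Unset Printing Implicit Defensive.

Import Order.TTheory GRing.Theory Num.Theory.
Import numFieldNormedType.Exports.

Local Open Scope classical_set_scope.
Local Open Scope ring_scope.

(* measurableType extends pointedType; this is the only reason for asking for a
   point in the alphabet and in the vertex set. *)
#[short(type="pcountType")]
HB.structure Definition PointedCountable := {T of Countable T & Pointed T}.

Definition seq_topology (A : pcountType) :=
  prod_topology (fun _ : nat => discrete_topology A).

Definition seq_space (A : pcountType) :=
  g_sigma_algebraType (@open (seq_topology A)).

(* An alias of V carrying the discrete sigma-algebra. *)
Definition vertices (V : pcountType) : Type := V.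

HB.instance Definition _ (V : pcountType) := PointedCountable.on (vertices V).
HB.instance Definition _ (V : pcountType) :=
  @isMeasurable.Build default_measure_display (vertices V)
    discrete_measurable discrete_measurable0
    discrete_measurableC discrete_measurableU.

Section counting_vertices.
Context (R : realType) (V : pcountType).

Definition mV : set (vertices V) -> \bar R := @counting (vertices V) R.

HB.instance Definition _ := Measure.on mV.

Let mV_sigma_finite : sigma_finite [set: vertices V] mV.
Proof.
exists (fun n => [set v : vertices V | choice.pickle v = n]).
  by apply/seteqP; split=> // v _; exists (choice.pickle v).
move=> n; split => //; rewrite /mV /counting asboolT ?ltry//.
case: (pselect (exists v : vertices V, choice.pickle v = n)) => [[v vn]|nv].
  apply: (@sub_finite_set _ _ [set v]); last exact: finite_set1.
  by move=> w /= wn; apply: (pcan_inj (@choice.pickleK (vertices V))); rewrite wn vn.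
rewrite (_ : mkset _ = set0) //; apply/seteqP; split => // v /= vn.
by apply: nv; exists v.
Qed.

HB.instance Definition _ :=
  Measure_isSigmaFinite.Build _ _ _ mV mV_sigma_finite.

End counting_vertices.
Arguments mV R V : clear implicits.

Section full_shift.
Context (A : pcountType).
Local Notation X := (seq_space A).

Definition theta (x : X) : X := fun n => x n.+1.

Definition scons (a : A) (x : X) : X := fun n => if n is m.+1 then x m else a.

Definition tau (w : seq A) (x : X) : X := foldr scons x w.

Definition cylinder (w : seq A) : set X := [set x | mkseq x (size w) = w].

Lemma tau_image (w : seq A) (B : set X) :
  tau w @` B = cylinder w `&` iter (size w) theta @^-1` B.
Proof.
elim: w B => [|a w IH] B.
  rewrite /tau /=; apply/seteqP; split=> [x [y By <-]|x [_ Bx]]; first by split.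
  by exists x.
have mkseqS (x : X) n : mkseq x n.+1 = x 0%N :: mkseq (theta x) n.
  by rewrite /mkseq /= (iotaDl 1 0) -map_comp.
have -> : tau (a :: w) @` B = scons a @` (tau w @` B) by rewrite -image_comp.
rewrite IH; apply/seteqP; split=> [_ [y [cy By] <-]|x [cx Bx]].
  split; last first.
    by change (B (iter (size w).+1 theta (scons a y))); rewrite iterSr.
  change (mkseq (scons a y) (size w).+1 = a :: w); rewrite mkseqS.
  by congr cons; exact: cy.
have {cx} [xa xw] : x 0%N :: mkseq (theta x) (size w) = a :: w.
  by rewrite -mkseqS.
exists (theta x); last by apply/funext => -[|n] /=.
split => //; change (B (iter (size w) theta (theta x))).
by rewrite -iterSr; exact: Bx.
Qed.

Lemma coord_continuous (i : nat) :
  continuous (fun x : seq_topology A => x i : discrete_topology A).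
Proof.
exact: (@proj_continuous nat (fun _ => discrete_topology A) i).
Qed.

Lemma measurable_cylinder (w : seq A) : measurable (cylinder w).
Proof.
rewrite (_ : cylinder w = \bigcap_i [set x : X | (i < size w)%N ->
    x i = nth point w i]).
  apply: bigcapT_measurable => i; apply: sub_sigma_algebra.
  apply: (@open_comp _ _ (fun x : seq_topology A => x i : discrete_topology A)
    [set b | (i < size w)%N -> b = nth point w i]).
    by move=> x _; exact: coord_continuous.
  exact: discrete_open.
apply/seteqP; split => x /=.
  by move=> xw i _ /= iw; rewrite -[in RHS]xw nth_mkseq.
move=> xw; apply: (@eq_from_nth _ point); rewrite size_mkseq // => i iw.
by rewrite nth_mkseq // xw.
Qed.

Lemma continuous_theta :
  continuous (theta : seq_topology A -> seq_topology A).
Proof.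
move=> x.
have F : Filter (nbhs x) by exact: nbhs_filter.
have F2 : Filter (fmap (theta : seq_topology A -> seq_topology A) (nbhs x)).
  exact: fmap_filter.
apply/(cvg_sup _ _ F2) => i Q /= [_ [[B Bop <-] Bx] BQ].
have nB : nbhs (x i.+1 : discrete_topology A) B by apply: open_nbhs_nbhs.
have := @coord_continuous i.+1 x _ nB.
rewrite /nbhs /=; apply: (@filterS _ _ F) => y By; exact: BQ.
Qed.

Lemma measurable_theta : measurable_fun [set: X] theta.
Proof.
apply: (@measurability _ _ X X setT theta (@open (seq_topology A))) => //.
move=> _ [B oB <-]; rewrite setTI; apply: sub_sigma_algebra.
by apply: open_comp oB => x _; exact: continuous_theta.
Qed.

Lemma measurable_tau_image (w : seq A) (B : set X) :
  measurable B -> measurable (tau w @` B).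
Proof.
move=> mB; rewrite tau_image; apply: measurableI.
  exact: measurable_cylinder.
elim: (size w) => [//|n IH].
rewrite (_ : _ @^-1` B = theta @^-1` (iter n theta @^-1` B)); last first.
  by apply/seteqP; split => x /=; rewrite -iterSr.
by rewrite -[X in measurable X]setTI; apply: measurable_theta.
Qed.

Lemma tau_inj (w : seq A) : injective (tau w).
Proof.
elim: w => [//|a w IH] x y /= xy; apply: IH.
by apply/funext => n; have := congr1 (@^~ n.+1) xy.
Qed.

End full_shift.

Section measure_tau.
Context (R : realType) (A : pcountType).
Local Notation X := (seq_space A).
Variable mu : probability X R.

Definition mu_tau (w : seq A) (B : set X) : \bar R := mu (tau w @` B).

Section instances.
Variable w : seq A.

Let mu_tau0 : mu_tau w set0 = 0%E.
Proof. by rewrite /mu_tau image_set0 measure0. Qed.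

Let mu_tau_ge0 B : (0 <= mu_tau w B)%E.
Proof. exact: measure_ge0. Qed.

Let mu_tau_sigma_additive : semi_sigma_additive (mu_tau w).
Proof.
move=> F mF tF mU; rewrite /mu_tau image_bigcup.
apply: measure_semi_sigma_additive.
- by move=> i; exact: measurable_tau_image.
- apply/trivIsetP => i j _ _ ij; apply/seteqP; split => // x.
  move=> [[y Fiy <-] [z Fjz /tau_inj zy]]; rewrite zy in Fjz.
  move/trivIsetP : tF => /(_ i j Logic.I Logic.I ij) FF.
  by have : (F i `&` F j) y; [split|rewrite FF].
- by rewrite -image_bigcup; exact: measurable_tau_image.
Qed.

HB.instance Definition _ := isMeasure.Build _ _ _ (mu_tau w)
  mu_tau0 mu_tau_ge0 mu_tau_sigma_additive.

Let mu_tau_fin : fin_num_fun (mu_tau w).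
Proof.
by move=> B mB; apply: fin_num_measure; exact: measurable_tau_image.
Qed.

HB.instance Definition _ := Measure_isFinite.Build _ _ _ (mu_tau w) mu_tau_fin.

End instances.

(* A version of d(mu o tau_w)/dmu; Radon_Nikodym is -oo everywhere when
   mu o tau_w is not absolutely continuous, whence the condition in log_holder. *)
Definition phi (w : seq A) : X -> \bar R :=
  Radon_Nikodym (charge_of_finite_measure (mu_tau w)) mu.

Definition dist_r (r : R) (x y : X) : R :=
  match pselect (exists i, x i != y i) with
  | left xy => r ^+ ex_minn xy
  | right _ => 0
  end.

Definition theta_invariant :=
  forall B : set X, measurable B -> mu (@theta A @^-1` B) = mu B.

Definition log_holder :=
  [/\ forall w, (0 < mu (cylinder w))%E,
      forall w, mu_tau w `<< mu,
      forall w, \forall x \ae mu, (0 < phi w x < +oo)%E &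
      exists C r : R, [/\ 0 < C, 0 < r < 1 &
        forall w, \forall z \ae (mu \x mu)%E,
          `| ln (fine (phi w z.1)) - ln (fine (phi w z.2)) |
            <= C * dist_r r z.1 z.2]].

(* dmu/d(mu o theta) on the injectivity regions [a] of theta: its value at
   tau_a x is phi_a x, and y = tau_(y 0) (theta y). *)
Definition dmu_dtheta (y : X) : R := fine (phi [:: y 0%N] (theta y)).

End measure_tau.

Section extension.
Context (R : realType) (A V : pcountType).
Local Notation X := (seq_space A).
Local Notation VV := (vertices V).
Variables (mu : probability X R) (kappa : X -> V -> V).

Definition skew_product (z : X * VV) : X * VV := (theta z.1, kappa z.1 z.2).

Definition topologically_transitive :=
  forall (a b : A) (u v : V), exists2 n, (1 <= n)%N &
    (0 < (mu \x mV R V)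
           ((iter n skew_product @` (cylinder [:: a] `*` [set u : VV])) `&`
            (cylinder [:: b] `*` [set v : VV])))%E.

Definition uniform_loops :=
  exists2 J : set X, finite_set J &
    forall v : V, [set kappa x v | x in J] v.

Definition edge_prob (e : V * V) : \bar R :=
  mu [set x | kappa x e.1 = e.2].

Definition eps_boundary (E : set (V * V)) (eps : R) (K : {fset V}) : {fset V} :=
  [fset v in K | `[< exists e, [/\ E e, e.1 = v, e.2 \notin K &
                                  (eps%:E < edge_prob e)%E] >]]%fset.

Definition mu_amenable (E : set (V * V)) :=
  (fun eps : R => ereal_inf
    [set ((#|` eps_boundary E eps K|%:R / #|` K|%:R : R)%:E)
      | K in [set K : {fset V} | K != fset0]]) @ 0^'+ --> 0%E.

(* esum is only meaningful for nonnegative terms, so the sum over the countable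
   fibre is the sum of positive parts minus that of negative parts; it converges
   absolutely for almost every z when g is in Hinf. *)
Definition transfer (g : X * VV -> R) (z : X * VV) : R :=
  let G y := (dmu_dtheta mu y.1 * g y)%:E in
  fine (\esum_(y in skew_product @^-1` [set z]) (G^\+ y)
        - \esum_(y in skew_product @^-1` [set z]) (G^\- y))%E.

(* Elements of the Banach space are represented by functions rather than classes:
   Hnorm f is the norm of the class of f, possibly +oo. *)
Definition Hnorm (f : X * VV -> R) : \bar R :=
  sqrte (\esum_(v in [set: VV]) ('N[mu]_+oo[EFin \o (fun x => f (x, v))] ^+ 2))%E.

Definition Hinf : set (X * VV -> R) :=
  [set f | measurable_fun [set: X * VV] f /\ (Hnorm f < +oo)%E].

Definition Hopnorm (L : (X * VV -> R) -> (X * VV -> R)) : \bar R :=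
  ereal_sup [set Hnorm (L f) | f in [set f | Hinf f /\ (Hnorm f <= 1)%E]].

Definition spectral_radius (L : (X * VV -> R) -> (X * VV -> R)) : \bar R :=
  limn (fun k => poweR (Hopnorm (iter k L)) (k%:R^-1)).

End extension.

(* Main.v *)
Require Import Defs.
From mathcomp Require Import all_boot all_order all_algebra finmap.
From mathcomp Require Import all_classical all_reals all_analysis.
From mathcomp Require Import measurable_realfun ess_sup_inf ring lra.
Set Implicit Arguments.
Unset Strict Implicit.
Unset Printing Implicit Defensive.
Import Order.TTheory GRing.Theory Num.Theory.
Import numFieldNormedType.Exports.
Local Open Scope classical_set_scope.
Local Open Scope ring_scope.

(* Let [q u a] be the mu-measure of [au] divided by that of [u]. The Hoelder
   condition says that the Jacobian at [ax] is [q (x_0 .. x_(k-1)) a] up to a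
   factor [exp (C r^k)], so every iterate of the transfer operator is comparable,
   uniformly in the number of iterations, with an iterate of the averaging
   operator [P G u v = sum_a q u a * G (au) (kappa_a^-1 v)], in which the
   continuous variable [x] has been replaced by finite words [u]. Both (1) and (3)
   are equivalent to a Foelner condition for the weighted graph with edges
   [v -> kappa_a v] of weight [mu [a]].

   A Foelner set loses only a small proportion of its mass under a fixed number of
   applications of [P]; this bounds the iterated operator norms from below.
   Conversely, if there is no Foelner set, the norm
   [sup_u |P^n h (u, .)|_2] decays exponentially. Otherwise some [P^N] nearly
   preserves it, and by strict convexity of l^2 the vectors averaged by [P^N] are
   nearly equal. Comparing the words [c^m a u] and [c^m b u], whose vectors are
   close by the Hoelder condition, gives a vector [psi] such that all the
   [psi o kappa_a^-1] nearly agree; the uniform loops force the common value to be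
   [psi] itself, and Cheeger's argument applied to [psi^2] produces a Foelner set. *)

(** * Sums over countable sets and averaging operators *)

(** It is replaced by a loss estimate which, to be iterated, must hold at every starting word, since
    [P] passes from [u] to longer words; this is why the norm is a supremum over [u]. Letters are
    prepended, so a block [c^m] added last hides the letter [a] behind a long common prefix. The
    price is the weight of one fixed path, which has to be bounded below uniformly in [a]; hence the
    letters are first cut down to a finite set that still contains those of the loops. Words also
    remove null sets: cylinders have positive mass, inequalities for [P] hold everywhere, and almost
    everywhere statements enter only when [P] is compared with the transfer operator. The recurring
    constant [C / (1 - r)] is the sum of the distortions [C * r ^+ j]. *)

Section esum_extra.
Local Open Scope ereal_scope.
Context (R : realType).

Lemma ge_esum_fset (T : choiceType) (D : set T) (f : T -> \bar R) x :
  (forall K : {fset T}, [set` K] `<=` D -> \sum_(i <- K) f i <= x) ->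
  \esum_(i in D) f i <= x.
Proof.
move=> fx; apply: ge_ereal_sup => _ [X [finX XD] <-].
rewrite fsbig_finite//; apply: fx; apply: subset_trans XD => t /=.
by rewrite in_fset_set// inE.
Qed.

Lemma le_esum_fset (T : choiceType) (D : set T) (f : T -> \bar R)
  (K : {fset T}) : [set` K] `<=` D -> \sum_(i <- K) f i <= \esum_(i in D) f i.
Proof.
move=> KD; apply: esum_ge; exists [set` K]; first by split.
by rewrite fsbig_finite// set_fsetK.
Qed.

Lemma esum_ge_term (T : choiceType) (D : set T) (f : T -> \bar R) t :
  D t -> f t <= \esum_(i in D) f i.
Proof.
move=> Dt; apply: le_trans (@le_esum_fset _ _ f [fset t]%fset _).
  by rewrite big_seq_fset1.
by move=> _ /= /fset1P ->.
Qed.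

(** Only one inequality is proved directly; applied with the inverse of [c] it gives the other. *)
Lemma esumZl (T : choiceType) (D : set T) (c : R) (f : T -> \bar R) :
  (0 <= c)%R -> (forall i, D i -> 0 <= f i) ->
  \esum_(i in D) (c%:E * f i) = c%:E * \esum_(i in D) f i.
Proof.
have le (c' : R) (g : T -> \bar R) : (0 <= c')%R -> (forall i, D i -> 0 <= g i) ->
    \esum_(i in D) (c'%:E * g i) <= c'%:E * \esum_(i in D) g i.
  move=> c0 g0; apply: ge_esum_fset => K KD.
  rewrite big_seq -ge0_sume_distrr; last by move=> i iK; apply/g0/KD.
  by rewrite -big_seq lee_wpmul2l ?lee_fin// le_esum_fset.
move=> c0 f0; apply/eqP; rewrite eq_le le//=.
have [->|cn0] := eqVneq c 0%R.
  by rewrite mul0e esum_ge0// => i _; rewrite mul0e.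
have -> : \esum_(i in D) f i = \esum_(i in D) (c^-1%:E * (c%:E * f i)).
  by apply: eq_esum => i _; rewrite muleA -EFinM mulVf// mul1e.
apply: (@le_trans _ _ (c%:E * (c^-1%:E * \esum_(i in D) (c%:E * f i)))).
  rewrite lee_wpmul2l ?lee_fin// le ?invr_ge0// => i Di.
  by rewrite mule_ge0 ?f0// lee_fin.
by rewrite muleA -EFinM mulfV// mul1e.
Qed.

Lemma exchange_esum (T U : choiceType) (f : T -> U -> \bar R) :
  (forall t u, 0 <= f t u) ->
  \esum_(t in setT) \esum_(u in setT) f t u =
  \esum_(u in setT) \esum_(t in setT) f t u.
Proof.
move=> f0; rewrite (esum_esum (J := fun=> setT))//.
rewrite [RHS](esum_esum (J := fun=> setT))//.
rewrite (reindex_esum (setT `*`` fun=> setT) (setT `*`` fun=> setT)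
  (fun x : U * T => (x.2, x.1)))//.
split => //= [[u t] [u' t'] _ _ [-> ->]//|[t u] _].
by exists (u, t).
Qed.

Lemma esum_bij (T : choiceType) (s : T -> T) (f : T -> \bar R) :
  bijective s -> \esum_(i in setT) f (s i) = \esum_(i in setT) f i.
Proof.
move=> [s' sK s'K]; rewrite [RHS](reindex_esum setT setT s)//; split => //.
  by move=> x y _ _; exact: (can_inj sK).
by move=> y _; exists (s' y).
Qed.

End esum_extra.

Section walk.
Context (R : realType) (A V : choiceType).
Variables (q : seq A -> A -> R) (s : A -> V -> V) (C r : R).
Hypothesis q_gt0 : forall u a, 0 < q u a.
Hypothesis q_sum : forall u, (\esum_(a in [set: A]) (q u a)%:E = 1)%E.
Hypothesis C_gt0 : 0 < C.
Hypothesis r01 : 0 < r < 1.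
Hypothesis q_holder : forall k u u' a, (k <= size u)%N -> (k <= size u')%N ->
  take k u = take k u' -> q u a <= expR (C * r ^+ k) * q u' a.
Hypothesis s_bij : forall a, bijective (s a).

Implicit Types (G H : seq A -> V -> \bar R) (u w : seq A) (v : V).

Definition walk G u v : \bar R :=
  (\esum_(a in [set: A]) ((q u a)%:E * G (a :: u) (s a v)))%E.

Let q_ge0 u a : 0 <= q u a. Proof. exact: ltW. Qed.
Local Hint Resolve q_ge0 : core.

Local Open Scope ereal_scope.

Lemma walk_ge0 G : (forall u v, 0 <= G u v) -> forall u v, 0 <= walk G u v.
Proof. by move=> G0 u v; apply: esum_ge0 => a _; rewrite mule_ge0 ?lee_fin. Qed.

Lemma le_walk G H : (forall u v, G u v <= H u v) ->
  forall u v, walk G u v <= walk H u v.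
Proof.
by move=> GH u v; apply: le_esum => a _; rewrite lee_wpmul2l ?lee_fin.
Qed.

Lemma walkD G H : (forall u v, 0 <= G u v) -> (forall u v, 0 <= H u v) ->
  walk (fun u v => G u v + H u v) = (fun u v => walk G u v + walk H u v).
Proof.
move=> G0 H0; apply/funext => u; apply/funext => v; rewrite /walk -esumD.
- by apply: eq_esum => a _; rewrite ge0_muleDr.
- by move=> a _; rewrite mule_ge0 ?lee_fin.
- by move=> a _; rewrite mule_ge0 ?lee_fin.
Qed.

Lemma walkZ c G : (0 <= c)%R -> (forall u v, 0 <= G u v) ->
  walk (fun u v => c%:E * G u v) = (fun u v => c%:E * walk G u v).
Proof.
move=> c0 G0; apply/funext => u; apply/funext => v; rewrite /walk -esumZl//.
  by apply: eq_esum => a _; rewrite muleCA.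
by move=> a _; rewrite mule_ge0 ?lee_fin.
Qed.

Lemma walk_cst c : (0 <= c)%R -> walk (fun _ _ => c%:E) = (fun _ _ => c%:E).
Proof.
move=> c0; apply/funext => u; apply/funext => v; rewrite /walk.
under eq_esum do rewrite muleC.
by rewrite esumZl ?q_sum ?mule1// => a _; rewrite lee_fin.
Qed.

Lemma iter_walk_ge0 n G : (forall u v, 0 <= G u v) ->
  forall u v, 0 <= iter n walk G u v.
Proof. by move=> G0; elim: n => [//|n IH] u v; exact: walk_ge0. Qed.

Lemma le_iter_walk n G H : (forall u v, G u v <= H u v) ->
  forall u v, iter n walk G u v <= iter n walk H u v.
Proof. by move=> GH; elim: n => [//|n IH] u v; exact: le_walk. Qed.

Lemma iter_walkD n G H :
  (forall u v, 0 <= G u v) -> (forall u v, 0 <= H u v) ->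
  iter n walk (fun u v => G u v + H u v) =
  (fun u v => iter n walk G u v + iter n walk H u v).
Proof.
move=> G0 H0; elim: n => [//|n IH]; rewrite iterS IH walkD//.
all: by move=> u v; exact: iter_walk_ge0.
Qed.

Lemma iter_walkZ n c G : (0 <= c)%R -> (forall u v, 0 <= G u v) ->
  iter n walk (fun u v => c%:E * G u v) = (fun u v => c%:E * iter n walk G u v).
Proof.
move=> c0 G0; elim: n => [//|n IH]; rewrite iterS IH walkZ// => u v.
exact: iter_walk_ge0.
Qed.

Lemma iter_walk_cst n c : (0 <= c)%R ->
  iter n walk (fun _ _ => c%:E) = (fun _ _ => c%:E).
Proof. by move=> c0; elim: n => [//|n IH]; rewrite iterS IH walk_cst. Qed.

(** Each [s a] permutes the vertices and the weights sum to 1. The bound [M] is asked at all words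
    because the letter [a] replaces [u] by [a :: u]. *)
Lemma esum_walk G M u : (forall u v, 0 <= G u v) ->
  (forall u, \esum_(v in [set: V]) G u v <= M) ->
  \esum_(v in [set: V]) walk G u v <= M.
Proof.
move=> G0 GM; rewrite /walk exchange_esum; last first.
  by move=> v a; rewrite mule_ge0 ?lee_fin.
have M0 : 0 <= M by apply: le_trans (GM [::]); exact: esum_ge0.
apply: (@le_trans _ _ (\esum_(a in [set: A]) ((q u a)%:E * M))).
  apply: le_esum => a _; rewrite esumZl//.
  apply: lee_wpmul2l; first by rewrite lee_fin.
  by rewrite (esum_bij (fun v => G (a :: u) v) (s_bij a)).
case: M M0 {GM} => [M M0|_|]; [|exact: leey|by []].
under eq_esum do rewrite muleC.
by rewrite esumZl ?q_sum ?mule1// => a _; rewrite lee_fin.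
Qed.

Lemma esum_iter_walk n G M u : (forall u v, 0 <= G u v) ->
  (forall u, \esum_(v in [set: V]) G u v <= M) ->
  \esum_(v in [set: V]) iter n walk G u v <= M.
Proof.
move=> G0 GM; elim: n u => [//|n IH] u; apply: esum_walk => // u' v.
exact: iter_walk_ge0.
Qed.

Definition path_act v w : V := foldl (fun v a => s a v) v w.

Lemma path_act_bij w : bijective (path_act ^~ w).
Proof.
elim: w => [|a w IH]; first by exists id.
exact: (bij_comp IH (s_bij a)).
Qed.

(** A lower bound for the probability of following [w] that does not depend on the starting word:
    the Hoelder bound at [k = 0] compares every [q u] with [q [::]]. *)
Definition path_weight w : R := (\prod_(a <- w) (expR (- C) * q [::] a))%R.

Lemma path_weight_gt0 w : (0 < path_weight w)%R.
Proof. by apply: prodr_gt0 => a _; rewrite mulr_gt0 ?expR_gt0. Qed.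

Lemma q_nil_le u a : (expR (- C) * q [::] a <= q u a)%R.
Proof.
have := @q_holder 0 [::] u a isT isT; rewrite !take0 expr0 mulr1 => /(_ erefl).
by move=> H; rewrite expRN mulrC ler_pdivrMr ?expR_gt0// mulrC.
Qed.

Lemma q_le_nil u a : (q u a <= expR C * q [::] a)%R.
Proof.
have := @q_holder 0 u [::] a isT isT; rewrite !take0 expr0 mulr1.
exact.
Qed.

(** One path is kept out of the iterated sum. Its letters are prepended in turn, so the final word
    is [catrev w u]. *)
Lemma iter_walk_ge_path w G u v : (forall u v, 0 <= G u v) ->
  (path_weight w)%:E * G (catrev w u) (path_act v w) <=
  iter (size w) walk G u v.
Proof.
move=> G0; elim: w u v => [|a w IH] u v.
  by rewrite /path_weight big_nil mul1e.
apply: le_trans (esum_ge_term _ (t := a) _) => //=.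
rewrite /path_weight big_cons -/(path_weight w) EFinM -muleA.
apply: (@le_trans _ _ ((q u a)%:E *
  ((path_weight w)%:E * G (catrev w (a :: u)) (path_act (s a v) w)))).
  rewrite lee_wpmul2r ?lee_fin ?q_nil_le//.
  by rewrite mule_ge0// lee_fin ltW// path_weight_gt0.
by rewrite lee_wpmul2l ?lee_fin.
Qed.

(** Every step prepends the same letter to both words, which then agree on one more place; the
    distortions form a geometric series, so the constant does not depend on [n]. *)
Lemma iter_walk_holder n (h : V -> \bar R) k u u' v :
  (forall v, 0 <= h v) ->
  (k <= size u)%N -> (k <= size u')%N -> take k u = take k u' ->
  iter n walk (fun=> h) u v <=
  (expR (C / (1 - r) * r ^+ k))%:E * iter n walk (fun=> h) u' v.
Proof.
move=> h0; elim: n k u u' v => [|n IH] k u u' v ku ku' uu'.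
  rewrite /= lee_pemull// lee_fin -[leLHS]expR0 ler_expR.
  case/andP: r01 => r0 r1.
  have C0 := C_gt0; apply: mulr_ge0; last by apply: exprn_ge0; lra.
  by apply: divr_ge0; lra.
rewrite iterS {1 3}/walk -esumZl ?expR_ge0//; last first.
  by move=> a _; rewrite mule_ge0 ?iter_walk_ge0 ?lee_fin.
apply: le_esum => a _.
have -> : expR (C / (1 - r) * r ^+ k) =
    (expR (C * r ^+ k) * expR (C / (1 - r) * r ^+ k.+1))%R.
  rewrite -expRD; congr expR; rewrite exprS.
  by field; case/andP: r01 => r0 r1; rewrite subr_eq0 gt_eqF.
rewrite EFinM -!muleA [(expR (_ * r ^+ k.+1))%:E * _]muleCA.
rewrite muleA -EFinM; apply: lee_pmul; rewrite ?lee_fin ?iter_walk_ge0//.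
  exact: q_holder.
by apply: IH => //=; rewrite uu'.
Qed.

(* The variance identity [E (g - t)^2 + t^2 = E g^2], where [E] is the iterated
   walk and [t = E g], keeping only the term of the path [w] in the variance. *)
Lemma iter_walk_variance w (g f : seq A -> V -> R) u v :
  (forall u v, 0 <= g u v)%R ->
  iter (size w) walk (fun u v => (g u v)%:E) u v = (f u v)%:E ->
  (f u v ^+ 2 +
   path_weight w * (g (catrev w u) (path_act v w) - f u v) ^+ 2)%:E <=
  iter (size w) walk (fun u v => (g u v ^+ 2)%:E) u v.
Proof.
move=> g0 fE; set t := f u v.
have t0 : (0 <= t)%R.
  by rewrite -lee_fin -fE iter_walk_ge0// => *; rewrite lee_fin.
(* The identity is written without subtraction, so that additivity of the walk on nonnegative
   functions applies to both sides. *)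
have gt : (fun u v => (g u v ^+ 2)%:E + (t ^+ 2)%:E) =
    (fun u v => ((g u v - t) ^+ 2)%:E + (2 * t)%:E * (g u v)%:E).
  apply/funext => u'; apply/funext => v'; rewrite -EFinM -!EFinD; congr EFin.
  ring.
have := congr1 (fun G => iter (size w) walk G u v) gt.
have t20 : (0 <= 2 * t)%R by rewrite mulr_ge0.
rewrite iter_walkD; [|by move=> *; rewrite lee_fin sqr_ge0..].
rewrite (@iter_walkD _ (fun u v => ((g u v - t) ^+ 2)%:E)); last 2 first.
- by move=> *; rewrite lee_fin sqr_ge0.
- by move=> *; rewrite mule_ge0 ?lee_fin.
rewrite iter_walkZ ?iter_walk_cst ?sqr_ge0// fE -/t => E.
have H := @iter_walk_ge_path w (fun u v => ((g u v - t) ^+ 2)%:E) u v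
  (fun _ _ => sqr_ge0 _).
suff : (t ^+ 2 + path_weight w *
      (g (catrev w u) (path_act v w) - t) ^+ 2)%:E + (t ^+ 2)%:E <=
    iter (size w) walk (fun u v => (g u v ^+ 2)%:E) u v + (t ^+ 2)%:E.
  by rewrite leeD2rE.
rewrite E; apply: le_trans (leeD H (lexx _)).
by rewrite -!EFinM -!EFinD lee_fin; lra.
Qed.

End walk.

(** * Cheeger's inequality *)

Section cheeger.
Context (R : realType) (A V : choiceType).
Variables (s : A -> V -> V) (c : A -> R) (F : {fset A}) (eps : R).
Hypothesis s_bij : forall a, bijective (s a).
Hypothesis c_ge0 : forall a, 0 <= c a.
Hypothesis c_le1 : \sum_(a <- F) c a <= 1.
Hypothesis eps_gt0 : 0 < eps.
Hypothesis isoperimetry : forall K : {fset V},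
  eps * #|` K|%:R <= \sum_(v <- K) \sum_(a <- F) c a * (s a v \notin K)%:R.

(* A discrete layer-cake formula: both sides are additive when a multiple of
   the indicator of the support is subtracted from [phi]. *)
Lemma layer_cake (K : {fset V}) (phi : V -> R) :
  (forall v, 0 <= phi v) -> (forall v, v \notin K -> phi v = 0) ->
  eps * \sum_(v <- K) phi v <=
  \sum_(v <- K) \sum_(a <- F) c a * Num.max 0 (phi v - phi (s a v)).
Proof.
have [n Kn] := ubnP #|` K|.
elim: n => // n IH in K phi Kn *.
move=> phi0 phiK.
have [->|[v1 v1K]] := fset_0Vmem K; first by rewrite !big_seq_fset0 mulr0.
have [[v0 v0K] _ /= v0min] :=
  @arg_minP _ _ K (FSetSub v1K) xpredT (fun v => phi (val v)) isT.
have {}v0min v : v \in K -> phi v0 <= phi v.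
  by move=> vK; exact: (v0min (FSetSub vK)).
set m := phi v0.
pose psi v := if v \in K then phi v - m else 0.
have psi0 v : 0 <= psi v.
  by rewrite /psi; case: ifP => // vK; rewrite subr_ge0 v0min.
have psi_v0 : psi v0 = 0 by rewrite /psi v0K subrr.
have := IH (K `\ v0)%fset psi; rewrite (cardfsD1 v0 K) v0K ltnS in Kn.
move=> /(_ Kn psi0) {}IH.
have {}IH : eps * \sum_(v <- K) psi v <=
    \sum_(v <- K) \sum_(a <- F) c a * Num.max 0 (psi v - psi (s a v)).
  rewrite (big_fsetD1 v0 v0K)/= psi_v0 add0r.
  rewrite [leRHS](big_fsetD1 v0 v0K)/= psi_v0 [X in X + _]big1 ?add0r.
    apply: IH => v; rewrite !inE negb_and negbK.
    by case/orP => [/eqP ->//|/negPf vK]; rewrite /psi vK.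
  by move=> a _; rewrite sub0r max_l ?mulr0// oppr_le0.
have -> : \sum_(v <- K) phi v = \sum_(v <- K) psi v + m * #|` K|%:R.
  rewrite card_fset_sum1 natr_sum mulr_sumr.
  rewrite -big_split/=; apply: eq_big_seq => v vK.
  by rewrite /psi vK mulr1 subrK.
have -> : \sum_(v <- K) \sum_(a <- F) c a * Num.max 0 (phi v - phi (s a v)) =
    \sum_(v <- K) \sum_(a <- F) c a * Num.max 0 (psi v - psi (s a v)) +
    m * \sum_(v <- K) \sum_(a <- F) c a * (s a v \notin K)%:R.
  rewrite mulr_sumr -big_split/=; apply: eq_big_seq => v vK.
  rewrite mulr_sumr -big_split/=; apply: eq_bigr => a _.
  rewrite [m * _]mulrCA -mulrDr; congr (_ * _); rewrite /psi vK.
  case: ifPn => savK; rewrite ?mulr0 ?addr0 ?mulr1.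
    by congr Num.max; ring.
  have m0 : 0 <= m by exact: phi0.
  rewrite (phiK _ savK) !subr0 !max_r ?subrK// subr_ge0; exact: v0min.
rewrite mulrDr mulrCA lerD// ler_wpM2l//; exact: phi0.
Qed.

(** [layer_cake] is applied to [psi ^+ 2] cut off outside a finite [K]. The cut-off costs at most
    the mass of [psi ^+ 2] outside [K], an error that vanishes when the supremum over [K] is
    taken. *)
Lemma cheeger (psi : V -> R) (W d : R) : (forall v, 0 <= psi v) ->
  0 < W -> (\esum_(v in [set: V]) (psi v ^+ 2)%:E = W%:E)%E ->
  (forall a, a \in F ->
    \esum_(v in [set: V]) ((psi (s a v) - psi v) ^+ 2)%:E <= (d * W)%:E)%E ->
  eps ^+ 2 <= 4 * d.
Proof.
move=> psi0 W0 WE dW.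
have [v0 _] : exists v : V, True.
  apply/not_existsP => noV; move: W0; rewrite -lte_fin -WE esum1 ?ltxx// => v _.
  by have := noV v.
have [F0|[a0 a0F]] := fset_0Vmem F.
  have := isoperimetry [fset v0]%fset.
  rewrite big_seq_fset1 F0 big_seq_fset0 cardfs1 mulr1.
  by move=> /(lt_le_trans eps_gt0); rewrite ltxx.
have sumW (K : {fset V}) : \sum_(v <- K) psi v ^+ 2 <= W.
  rewrite -lee_fin -WE -sumEFin; exact: le_esum_fset.
have sum_shift (K : {fset V}) a : \sum_(v <- K) psi (s a v) ^+ 2 <= W.
  rewrite -lee_fin -WE -(esum_bij (fun v => (psi v ^+ 2)%:E) (s_bij a)).
  rewrite -sumEFin; exact: le_esum_fset.
have sum_diff (K : {fset V}) a : a \in F ->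
    \sum_(v <- K) (psi (s a v) - psi v) ^+ 2 <= d * W.
  move=> aF; rewrite -lee_fin; apply: le_trans (dW a aF).
  rewrite -sumEFin; exact: le_esum_fset.
(* The points [s a v] that leave [K] are distinct and disjoint from [K], so their mass and that of
   [K] add up to at most [W]. *)
have sum_out (K : {fset V}) a :
    \sum_(v <- K) psi (s a v) ^+ 2 * (s a v \notin K)%:R <=
    W - \sum_(v <- K) psi v ^+ 2.
  rewrite lerBrDr.
  pose K' := [fset s a v | v in [fset v in K | s a v \notin K]]%fset.
  apply: le_trans (sumW (K' `|` K)%fset).
  have -> : \sum_(v <- (K' `|` K)%fset) psi v ^+ 2 =
      \sum_(v <- K') psi v ^+ 2 + \sum_(v <- K) psi v ^+ 2.
    rewrite -big_cat/=; apply: perm_big; apply: uniq_perm.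
    - exact: fset_uniq.
    - rewrite cat_uniq !fset_uniq andbT/=; apply/hasPn => v vK.
      apply/imfsetP => -[w /=]; rewrite !inE/= => /andP[_ swK] E.
      by rewrite -E vK in swK.
    - by move=> v; rewrite mem_cat inE.
  rewrite lerD2r big_imfset/=; last first.
    by move=> x y _ _; apply: bij_inj.
  rewrite big_fset/= le_eqVlt; apply/orP; left; apply/eqP.
  rewrite [RHS]big_mkcond/= ; apply: eq_bigr => v _.
  by case: (s a v \in K); rewrite ?mulr0 ?mulr1.
(* The bound to come is [eps <= d / (2 * t) + 2 * t]; with this [t] the last term is half of
   [eps]. *)
pose t := eps / 4.
have t0 : 0 < t by rewrite divr_gt0.
(* The loss [W - S] caused by the cut-off is split: [S] goes to the left, so the right-hand side no
   longer depends on [K]. *)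
have key (K : {fset V}) : (1 + eps) * \sum_(v <- K) psi v ^+ 2 <=
    (1 + (d / t + 4 * t) / 2) * W.
  pose phi v := if v \in K then psi v ^+ 2 else 0.
  have phi0 v : 0 <= phi v by rewrite /phi; case: ifP => // _; exact: sqr_ge0.
  have phiK v : v \notin K -> phi v = 0 by rewrite /phi => /negPf ->.
  have := layer_cake phi0 phiK.
  have -> : \sum_(v <- K) phi v = \sum_(v <- K) psi v ^+ 2.
    by apply: eq_big_seq => v vK; rewrite /phi vK.
  set S := \sum_(v <- K) psi v ^+ 2.
  have S0 : 0 <= S by apply: sumr_ge0 => v _; exact: sqr_ge0.
  (* The first three terms bound [x^2 - y^2 = (x - y) (x + y)] by the inequality of arithmetic and
     geometric means with parameter [t]; the last one pays for the cut-off at [s a v]. *)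
  pose b a v := (2 * t)^-1 * (psi (s a v) - psi v) ^+ 2 +
    t * psi v ^+ 2 + t * psi (s a v) ^+ 2 +
    psi (s a v) ^+ 2 * (s a v \notin K)%:R.
  have t20 : 0 < 2 * t by rewrite mulr_gt0.
  have b_ge a v : v \in K -> Num.max 0 (phi v - phi (s a v)) <= b a v.
    move=> vK; rewrite ge_max; apply/andP; split.
      by rewrite !addr_ge0// mulr_ge0 ?sqr_ge0// ?invr_ge0 ltW.
    have amgm x y : x ^+ 2 - y ^+ 2 <=
        (2 * t)^-1 * (y - x) ^+ 2 + t * x ^+ 2 + t * y ^+ 2.
      rewrite -(ler_pM2l t20) !mulrDr mulVKf ?gt_eqF//.
      have := sqr_ge0 (y - x + t * (x + y)).
      have := sqr_ge0 (t * (x - y)).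
      rewrite !expr2; nra.
    rewrite /phi vK /b; case: ifPn => savK; first by rewrite mulr0 addr0.
    rewrite subr0 mulr1; have := amgm (psi v) (psi (s a v)); lra.
  pose B := (d / t + 4 * t) / 2 * W + (W - S).
  have sum_b a : a \in F -> \sum_(v <- K) b a v <= B.
    move=> aF; rewrite /b !big_split/= -!mulr_sumr -/S.
    have t2V : 0 <= (2 * t)^-1 by rewrite invr_ge0 ltW.
    have h1 := ler_wpM2l t2V (sum_diff K a aF).
    have h2 := ler_wpM2l (ltW t0) (sumW K); rewrite -/S in h2.
    have h3 := ler_wpM2l (ltW t0) (sum_shift K a).
    have h4 := sum_out K a; rewrite -/S in h4.
    have -> : B = (2 * t)^-1 * (d * W) + t * W + t * W + (W - S).
      by rewrite /B; field; rewrite gt_eqF.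
    by rewrite !lerD.
  have B0 : 0 <= B.
    apply: le_trans (sum_b a0 a0F); rewrite big_seq; apply: sumr_ge0 => v vK.
    by apply: le_trans (b_ge a0 v vK); rewrite le_max lexx.
  move=> /le_trans lay.
  have {}lay : eps * S <= B.
    apply: lay; rewrite exchange_big/=.
    apply: (@le_trans _ _ (\sum_(a <- F) c a * B)); last first.
      by rewrite -mulr_suml -[leRHS]mul1r ler_wpM2r.
    rewrite big_seq [leRHS]big_seq; apply: ler_sum => a aF.
    rewrite -mulr_sumr ler_wpM2l//; apply: le_trans (sum_b a aF).
    by rewrite big_seq [leRHS]big_seq; apply: ler_sum => v; exact: b_ge.
  by move: lay; rewrite /B; lra.
have : (((1 + eps) * W)%:E <= ((1 + (d / t + 4 * t) / 2) * W)%:E)%E.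
  rewrite EFinM -WE -esumZl//; last 2 first.
  - by rewrite addr_ge0// ltW.
  - by move=> v _; rewrite lee_fin sqr_ge0.
  apply: ge_esum_fset => K _; under eq_bigr do rewrite -EFinM.
  by rewrite sumEFin lee_fin -mulr_sumr.
rewrite lee_fin ler_pM2r// lerD2l /t.
move=> H.
have : eps * (2 * eps) <= (d / (eps / 4) + 4 * (eps / 4)) / 2 * (2 * eps).
  by rewrite ler_pM2r// mulr_gt0.
have -> : (d / (eps / 4) + 4 * (eps / 4)) / 2 * (2 * eps) = 4 * d + eps ^+ 2.
  by field; rewrite gt_eqF.
by rewrite expr2; lra.
Qed.

End cheeger.

(** * Contraction without Foelner sets *)

Section real_extra.
Context (R : realType).

Lemma expR_sub1_le (x : R) : 0 <= x -> x <= 1 / 2 -> expR x - 1 <= 2 * x.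
Proof.
move=> x0 x1; have := expR_ge1Dx (- x); rewrite expRN.
have e0 := expR_gt0 x; rewrite -(ler_pM2r e0) mulVf ?gt_eqF//.
nra.
Qed.

Lemma exists_expr_lt (r e : R) : 0 < r < 1 -> 0 < e -> exists n, r ^+ n < e.
Proof.
case/andP => r0 r1 e0.
have : (fun n => r ^+ n) @ \oo --> (0 : R).
  by apply: cvg_expr; rewrite ger0_norm// ltW.
move/cvgrPdist_lt => /(_ _ e0) [n _ /(_ n (leqnn n))] /=.
by rewrite sub0r normrN ger0_norm ?exprn_ge0 1?ltW//; exists n.
Qed.

Lemma exists_lower_bound (T : eqType) (D : seq T) (p : T -> R) :
  (forall a, 0 < p a) -> exists2 k : R, 0 < k & forall a, a \in D -> k <= p a.
Proof.
move=> p0; elim: D => [|a D [k k0 kD]]; first by exists 1.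
exists (Num.min k (p a)); first by rewrite lt_min k0 p0.
move=> b; rewrite inE => /orP[/eqP ->|/kD]; rewrite ge_min ?lexx ?orbT//.
by move=> ->.
Qed.

Lemma le_esum_comb (T : choiceType) (p f g : T -> R) (a b x y : R) :
  0 <= a -> 0 <= b -> (forall v, 0 <= f v) -> (forall v, 0 <= g v) ->
  (forall v, p v <= a * f v + b * g v) ->
  (\esum_(v in [set: T]) (f v)%:E <= x%:E)%E ->
  (\esum_(v in [set: T]) (g v)%:E <= y%:E)%E ->
  (\esum_(v in [set: T]) (p v)%:E <= (a * x + b * y)%:E)%E.
Proof.
move=> a0 b0 f0 g0 pfg fx gy.
apply: (@le_trans _ _ (\esum_(v in [set: T])
    (a%:E * (f v)%:E + b%:E * (g v)%:E))%E).
  by apply: le_esum => v _; rewrite -!EFinM -EFinD lee_fin.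
rewrite esumD; last 2 first.
- by move=> v _; rewrite mule_ge0 ?lee_fin.
- by move=> v _; rewrite mule_ge0 ?lee_fin.
rewrite !esumZl//; last 2 first.
- by move=> v _; rewrite lee_fin.
- by move=> v _; rewrite lee_fin.
by rewrite EFinD !EFinM leeD// lee_wpmul2l ?lee_fin.
Qed.

End real_extra.

Section contraction.
Context (R : realType) (A V : choiceType).
Variables (q : seq A -> A -> R) (s : A -> V -> V) (C r : R).
Hypothesis q_gt0 : forall u a, 0 < q u a.
Hypothesis q_sum : forall u, (\esum_(a in [set: A]) (q u a)%:E = 1)%E.
Hypothesis C_gt0 : 0 < C.
Hypothesis r01 : 0 < r < 1.
Hypothesis q_holder : forall k u u' a, (k <= size u)%N -> (k <= size u')%N ->
  take k u = take k u' -> q u a <= expR (C * r ^+ k) * q u' a.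
Hypothesis s_bij : forall a, bijective (s a).

Local Notation walk := (walk q s).

Definition walk_boundary (K : {fset V}) : \bar R :=
  (\sum_(v <- K)
    \esum_(a in [set: A]) (q [::] a * (s a v \notin K)%:R)%:E)%E.

(** The letters outside [F] carry mass at most [e]. The proof passes to [1 - x], for which
    restricting the sum to [F] gives a lower bound. *)
Lemma esum_tail (F : {fset A}) (e : R) (x : A -> R) :
  1 - e <= \sum_(a <- F) q [::] a -> (forall a, 0 <= x a <= 1) ->
  (\esum_(a in [set: A]) (q [::] a * x a)%:E <=
   (\sum_(a <- F) q [::] a * x a + e)%:E)%E.
Proof.
move=> Fe x01.
have x0 a : 0 <= x a by case/andP: (x01 a).
have x1 a : 0 <= 1 - x a by case/andP: (x01 a) => _; rewrite subr_ge0.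
have q0 a : 0 <= q [::] a by rewrite ltW.
have := q_sum [::].
have -> : (fun a => (q [::] a)%:E) =
    (fun a => (q [::] a * x a)%:E + (q [::] a * (1 - x a))%:E)%E.
  by apply/funext => a; rewrite -EFinD -mulrDr addrC subrK mulr1.
rewrite esumD; [|by move=> a _; rewrite lee_fin mulr_ge0..].
have := @le_esum_fset R A setT (fun a => (q [::] a * (1 - x a))%:E) F
  (fun _ _ => I).
rewrite sumEFin.
have -> : \sum_(a <- F) q [::] a * (1 - x a) =
    \sum_(a <- F) q [::] a - \sum_(a <- F) q [::] a * x a.
  by rewrite -sumrB; apply: eq_bigr => a _; rewrite mulrBr mulr1.
have : (0 <= \esum_(a in [set: A]) (q [::] a * x a)%:E)%E.
  by apply: esum_ge0 => a _; rewrite lee_fin mulr_ge0.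
have : (0 <= \esum_(a in [set: A]) (q [::] a * (1 - x a))%:E)%E.
  by apply: esum_ge0 => a _; rewrite lee_fin mulr_ge0.
case: (\esum_(a in [set: A]) (q [::] a * x a)%:E)%E => [y| |//];
case: (\esum_(a in [set: A]) (q [::] a * (1 - x a))%:E)%E => [z| |//] //=.
rewrite !lee_fin => _ _ zF; rewrite -EFinD => -[yz]; lra.
Qed.

Lemma exists_fset_mass (e : R) : 0 < e ->
  exists F : {fset A}, 1 - e <= \sum_(a <- F) q [::] a.
Proof.
move=> e0; apply/not_existsP => noF.
suff : (1 <= (1 - e)%:E :> \bar R)%E by rewrite lee_fin => H; lra.
rewrite -(q_sum [::]); apply: ge_esum_fset => F _; rewrite sumEFin lee_fin.
by have /negP := noF F; rewrite -ltNge => /ltW.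
Qed.

Section contraction_step.
Variables (eps : R) (J : {fset A}).
Hypothesis eps_gt0 : 0 < eps.
Hypothesis boundary_gt : forall K : {fset V}, K != fset0 ->
  ((eps * #|` K|%:R)%:E < walk_boundary K)%E.
Hypothesis loops : forall v, exists2 a, a \in J & s a v = v.

(** Half of [eps] is given up to discard all but finitely many letters. *)
Lemma exists_isoperimetric_fset : exists2 F : {fset A}, (J `<=` F)%fset &
  forall K : {fset V}, eps / 2 * #|` K|%:R <=
    \sum_(v <- K) \sum_(a <- F) q [::] a * (s a v \notin K)%:R.
Proof.
have e2 : 0 < eps / 2 by rewrite divr_gt0.
have [F0 F0e] := exists_fset_mass e2.
exists (J `|` F0)%fset; first exact: fsubsetUl.
have Fe : 1 - eps / 2 <= \sum_(a <- (J `|` F0)%fset) q [::] a.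
  apply: (le_trans F0e).
  rewrite [leRHS](big_fsetID _ (mem F0))/=.
  have -> : [fset x | x in (J `|` F0)%fset & x \in F0]%fset = F0.
    by apply/fsetP => a; rewrite !inE; case: (a \in J) => //=; rewrite andbb.
  by rewrite lerDl; apply: sumr_ge0 => a _; rewrite ltW.
move=> K; have [->|K0] := eqVneq K fset0.
  by rewrite big_seq_fset0 cardfs0 mulr0.
have bd v : (\esum_(a in [set: A]) (q [::] a * (s a v \notin K)%:R)%:E <=
    (\sum_(a <- (J `|` F0)%fset) q [::] a * (s a v \notin K)%:R +
      eps / 2)%:E)%E.
  by apply: esum_tail => // a; case: (_ \notin _); rewrite ?lexx ler01.
have := le_trans (ltW (boundary_gt K0)) (lee_sum _ (fun v _ => bd v)).
rewrite sumEFin lee_fin big_split/= => H.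
have E : \sum_(v <- K) eps / 2 = eps / 2 * #|` K|%:R.
  by rewrite card_fset_sum1 natr_sum mulr_sumr; apply: eq_bigr => v _; rewrite mulr1.
by rewrite E in H; lra.
Qed.

(** The conditions on [g] are those that every iterate [P^n h] satisfies with constants independent
    of [n]; since [m] and [d] do not depend on [g], the step can be repeated. *)
Lemma contraction_step : exists m : nat, exists2 d : R, 0 < d < 1 &
  forall (g gN : seq A -> V -> R) (M : R),
  (forall u v, 0 <= g u v) ->
  (forall k u u' v, (k <= size u)%N -> (k <= size u')%N ->
    take k u = take k u' -> g u v <= expR (C / (1 - r) * r ^+ k) * g u' v) ->
  (forall u v, iter m.+1 walk (fun u v => (g u v)%:E) u v = (gN u v)%:E) ->
  (forall u, \esum_(v in [set: V]) (g u v ^+ 2)%:E <= M%:E)%E ->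
  forall u, (\esum_(v in [set: V]) (gN u v ^+ 2)%:E <= ((1 - d) * M)%:E)%E.
Proof.
have [F JF isoF] := exists_isoperimetric_fset.
have [c _] : exists c : A, True.
  apply/not_existsP => noA; have := q_sum [::]; rewrite esum1.
    by move/eqP; rewrite eq_sym onee_eq0.
  by move=> a _; have := noA a.
pose n0 : R := #|` F|%:R.
have n00 : 0 <= n0 by exact: ler0n.
(* The tolerance for squared distances relative to [M]: the minimum with 1 keeps the limit vector
   from being small, and the term in [eps] contradicts Cheeger's bound at the end. *)
pose z0 : R := Num.min (eps ^+ 2 / 20) 1 / (16 * (1 + n0)).
have n01 : 0 < 16 * (1 + n0) by lra.
have z00 : 0 < z0 by rewrite divr_gt0// lt_min ltr01 divr_gt0 ?exprn_gt0.
have z0n : 16 * (1 + n0) * z0 <= 1.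
  by rewrite /z0 mulrC divfK ?gt_eqF// ge_min lexx orbT.
have z0e : 16 * (1 + n0) * z0 <= eps ^+ 2 / 20.
  by rewrite /z0 mulrC divfK ?gt_eqF// ge_min lexx.
clearbody z0; pose C' := C / (1 - r).
have C'0 : 0 < C' by case/andP: r01 => r0 r1; rewrite divr_gt0 ?subr_gt0.
have [m mE] : exists m, (expR (C' * r ^+ m) - 1) ^+ 2 <= z0 / 4.
  have [|m] := @exists_expr_lt R r (Num.min (1 / 2) (z0 / 8) / C') r01.
    by rewrite divr_gt0// lt_min; apply/andP; split; lra.
  rewrite ltr_pdivlMr// lt_min mulrC => /andP[m1 m2]; exists m.
  have x0 : 0 <= C' * r ^+ m.
    case/andP: r01 => r0 _.
    by apply: mulr_ge0; [exact: ltW|apply: exprn_ge0; exact: ltW].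
  have := expR_sub1_le x0 (ltW m1).
  have : 0 <= expR (C' * r ^+ m) - 1 by rewrite subr_ge0 -[leLHS]expR0 ler_expR.
  set y := expR _ - 1; set x := C' * _ in x0 m1 m2 *; move=> y0 yx.
  rewrite expr2; nra.
set e := expR _ in mE.
(* The letter to be compared comes first and is then covered by [c^m]; the total length is [m.+1],
   the exponent in the statement. *)
pose w a := a :: nseq m c.
have [k k0 kF] := @exists_lower_bound R A F (fun a => path_weight q C (w a))
  (fun a => path_weight_gt0 C q_gt0 (w a)).
(* The variance estimate divides by the path weight [k], so [d / k] must stay below [z0 / 4]; the
   bound [1 / 4] leaves at least three quarters of [M]. *)
pose d := Num.min (1 / 4) (k * z0 / 4).
have kz0 : 0 < k * z0 / 4 by rewrite divr_gt0// mulr_gt0.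
have d0 : 0 < d by rewrite lt_min kz0 andbT; lra.
have d4 : d <= 1 / 4 by rewrite ge_min lexx.
have d1 : 0 <= 1 - d by lra.
have dk : d <= k * z0 / 4 by rewrite ge_min lexx orbT.
exists m, d; first by rewrite d0/=; lra.
move=> g gN M g0 g_reg gNE gM u; rewrite leNgt; apply/negP => big.
have fin_of (p : V -> R) (y : R) : (forall v, 0 <= p v) ->
    (\esum_(v in [set: V]) (p v)%:E <= y%:E)%E ->
    exists z, (\esum_(v in [set: V]) (p v)%:E = z%:E)%E.
  move=> p0; have : (0 <= \esum_(v in [set: V]) (p v)%:E)%E.
    by apply: esum_ge0 => v _; rewrite lee_fin.
  by case: (\esum_(v in [set: V]) _)%E => [z _ _|_ //|//]; exists z.
(* The vectors [psi a] are close to each other, because the words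
   [catrev (nseq m c) (a :: u)] have a common prefix of length [m]. *)
pose psi a v := g (catrev (nseq m c) (a :: u)) (path_act s v (nseq m c)).
pose psi' v := gN u v.
have var a : a \in F -> (\esum_(v in [set: V])
    (psi' v ^+ 2 + k * (psi a (s a v) - psi' v) ^+ 2)%:E <= M%:E)%E.
  move=> aF; apply: le_trans
    (esum_iter_walk q_gt0 q_sum s_bij m.+1 u _ gM); last first.
    by move=> u' v; rewrite lee_fin sqr_ge0.
  apply: le_esum => v _.
  have wm : size (w a) = m.+1 by rewrite /= size_nseq.
  rewrite -wm.
  apply: (@le_trans _ _ (psi' v ^+ 2 + path_weight q C (w a) *
      (psi a (s a v) - psi' v) ^+ 2)%:E).
    by rewrite lee_fin lerD2l ler_wpM2r ?sqr_ge0 ?kF.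
  apply: (iter_walk_variance q_gt0 q_sum q_holder g0).
  by rewrite wm gNE.
have [a0 a0F] : exists a, a \in F.
  have [F0|[a aF]] := fset_0Vmem F; last by exists a.
  have [v _] : exists v : V, True.
    apply/not_existsP => noV.
    have E0 (f : V -> \bar R) : (\esum_(v in [set: V]) f v = 0)%E.
      by rewrite esum1// => v _; have := noV v.
    have := gM u; rewrite E0 lee_fin => M0.
    by move: big; rewrite E0 lte_fin ltNge mulr_ge0.
  by have [a aJ _] := loops v; exists a; apply: (fsubsetP JF).
have psi'M : (\esum_(v in [set: V]) (psi' v ^+ 2)%:E <= M%:E)%E.
  apply: le_trans (var a0 a0F); apply: le_esum => v _.
  by rewrite lee_fin lerDl mulr_ge0 ?sqr_ge0// ltW.
have [S SE] := fin_of _ _ (fun v => sqr_ge0 (psi' v)) psi'M.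
have {}big : (1 - d) * M < S by rewrite -lte_fin -SE.
rewrite SE lee_fin in psi'M.
have M0 : 0 < M by rewrite -(pmulr_rgt0 _ d0); lra.
(* The variance term weighted by [k] fits between [S], which exceeds [(1 - d) * M], and [M]. *)
have close a : a \in F -> (\esum_(v in [set: V])
    ((psi a (s a v) - psi' v) ^+ 2)%:E <= (d / k * M)%:E)%E.
  move=> aF; have := var a aF.
  have -> : (fun v => (psi' v ^+ 2 + k * (psi a (s a v) - psi' v) ^+ 2)%:E) =
      (fun v => (psi' v ^+ 2)%:E + k%:E * ((psi a (s a v) - psi' v) ^+ 2)%:E)%E.
    by apply/funext => v; rewrite -EFinM -EFinD.
  rewrite esumD; last 2 first.
  - by move=> v _; rewrite lee_fin sqr_ge0.
  - by move=> v _; rewrite mule_ge0 ?lee_fin ?sqr_ge0// ltW.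
  rewrite SE esumZl; [|exact: ltW|by move=> v _; rewrite lee_fin sqr_ge0].
  have : (0 <= \esum_(v in [set: V]) ((psi a (s a v) - psi' v) ^+ 2)%:E)%E.
    by apply: esum_ge0 => v _; rewrite lee_fin sqr_ge0.
  case: (\esum_(v in [set: V]) _)%E => [z _|_|//].
    rewrite -EFinM -EFinD !lee_fin => kz.
    rewrite -(ler_pM2l k0) mulrA mulrCA divff ?gt_eqF// mulr1; lra.
  by rewrite gt0_muley ?lte_fin.
pose ps := psi a0.
have psM : (\esum_(v in [set: V]) (ps v ^+ 2)%:E <= M%:E)%E.
  have bij := path_act_bij s_bij (nseq m c).
  have := gM (catrev (nseq m c) (a0 :: u)).
  rewrite -(esum_bij (fun v => (g _ v ^+ 2)%:E) bij); exact.
have [W WE] := fin_of _ _ (fun v => sqr_ge0 (ps v)) psM.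
(* The Hoelder bound is multiplicative, so the error is relative to [ps v] and can be summed over
   the vertices. *)
have psi_close a v : a \in F -> (ps v - psi a v) ^+ 2 <= z0 / 4 * ps v ^+ 2.
  move=> aF; apply: (@le_trans _ _ ((e - 1) ^+ 2 * ps v ^+ 2)); last first.
    by rewrite ler_wpM2r// sqr_ge0.
  have take_w b : take m (catrev (nseq m c) (b :: u)) = rev (nseq m c).
    by rewrite catrevE take_size_cat// size_rev size_nseq.
  have size_w b : (m <= size (catrev (nseq m c) (b :: u)))%N.
    by rewrite catrevE size_cat size_rev size_nseq leq_addr.
  have reg b b' : psi b v <= e * psi b' v.
    by apply: g_reg; rewrite ?size_w ?take_w.
  have := reg a0 a; have := reg a a0; rewrite -/ps.
  have p0 : 0 <= psi a v by exact: g0.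
  have p1 : 0 <= ps v by exact: g0.
  have e1 : 1 <= e.
    rewrite /e -[leLHS]expR0 ler_expR; case/andP: r01 => r0 _.
    by apply: mulr_ge0; [exact: ltW|apply: exprn_ge0; exact: ltW].
  move=> h1 h2; rewrite -exprMn -[leLHS]real_normK ?num_real//.
  rewrite ler_pXn2r ?nnegrE ?mulr_ge0 ?subr_ge0//.
  by rewrite ler_norml; apply/andP; split; nra.
have zz : 2 * (z0 / 4) + 2 * (d / k) <= z0.
  have : d / k <= z0 / 4 by rewrite ler_pdivrMr// mulrC; lra.
  lra.
have D1 a : a \in F -> (\esum_(v in [set: V])
    ((ps (s a v) - psi' v) ^+ 2)%:E <= (z0 * M)%:E)%E.
  move=> aF; apply: (@le_trans _ _ (2 * (z0 / 4 * M) + 2 * (d / k * M))%:E).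
    apply: (@le_esum_comb _ _ _ (fun v => (ps (s a v) - psi a (s a v)) ^+ 2)
      (fun v => (psi a (s a v) - psi' v) ^+ 2)) => //.
    - by move=> v; exact: sqr_ge0.
    - by move=> v; exact: sqr_ge0.
    - move=> v; have := sqr_ge0 (ps (s a v) - psi a (s a v) -
        (psi a (s a v) - psi' v)); rewrite !expr2; lra.
    - rewrite (esum_bij (fun v => ((ps v - psi a v) ^+ 2)%:E) (s_bij a)).
      have -> : z0 / 4 * M = z0 / 4 * M + 0 * M by rewrite mul0r addr0.
      apply: (@le_esum_comb _ _ _ (fun v => ps v ^+ 2) (fun v => ps v ^+ 2)) => //.
      + lra.
      + by move=> v; exact: sqr_ge0.
      + by move=> v; exact: sqr_ge0.
      + by move=> v; rewrite mul0r addr0 psi_close.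
    - exact: close.
  by rewrite lee_fin [2 * (z0 / 4 * M)]mulrA [2 * (d / k * M)]mulrA -mulrDl ler_pM2r.
(* The loop letter depends on [v]; summing [D1] over all of [F] covers every choice at the cost of
   the factor [n0]. *)
have D2 : (\esum_(v in [set: V]) ((ps v - psi' v) ^+ 2)%:E <=
    (n0 * (z0 * M))%:E)%E.
  apply: (@le_trans _ _ (\esum_(v in [set: V])
      (\sum_(a <- F) ((ps (s a v) - psi' v) ^+ 2)%:E))%E).
    apply: le_esum => v _; have [a aJ av] := loops v.
    rewrite (big_fsetD1 a (fsubsetP JF a aJ))/= av leeDl//.
    by apply: sume_ge0 => b _; rewrite lee_fin sqr_ge0.
  rewrite esum_sum; last by move=> v a _ _; rewrite lee_fin sqr_ge0.
  apply: (@le_trans _ _ (\sum_(a <- F) (z0 * M)%:E)%E).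
    rewrite big_seq [leRHS]big_seq; apply: lee_sum => a; exact: D1.
  rewrite sumEFin lee_fin /n0 card_fset_sum1 natr_sum mulr_suml.
  by apply: ler_sum => a _; rewrite mul1r.
have D3 a : a \in F -> (\esum_(v in [set: V])
    ((ps (s a v) - ps v) ^+ 2)%:E <= (2 * (z0 * M) + 2 * (n0 * (z0 * M)))%:E)%E.
  move=> aF; apply: (@le_esum_comb _ _ _ (fun v => (ps (s a v) - psi' v) ^+ 2)
    (fun v => (ps v - psi' v) ^+ 2)) => //.
  - by move=> v; exact: sqr_ge0.
  - by move=> v; exact: sqr_ge0.
  - move=> v; have := sqr_ge0 (ps (s a v) - psi' v + (ps v - psi' v)).
    rewrite !expr2; lra.
  - exact: D1.
(* Since [ps] is close to [psi'], whose squared norm exceeds three quarters of [M], its own squared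
   norm [W] is at least [M / 8]; the errors thus become relative to [W]. *)
have D4 : S <= 2 * W + 2 * (n0 * (z0 * M)).
  rewrite -lee_fin -SE.
  apply: (@le_esum_comb _ _ _ (fun v => ps v ^+ 2)
    (fun v => (ps v - psi' v) ^+ 2)) => //.
  - by move=> v; exact: sqr_ge0.
  - by move=> v; exact: sqr_ge0.
  - move=> v; have := sqr_ge0 (2 * ps v - psi' v).
    rewrite !expr2; lra.
  - by rewrite WE.
have zM : 16 * (z0 * M) + 16 * (n0 * (z0 * M)) <= M.
  have -> : 16 * (z0 * M) + 16 * (n0 * (z0 * M)) = 16 * (1 + n0) * z0 * M.
    by ring.
  by rewrite -[leRHS]mul1r ler_pM2r.
have zM0 : 0 < z0 * M by rewrite mulr_gt0.
have dM : d * M <= 1 / 4 * M by rewrite ler_pM2r.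
have WM : M <= 8 * W by lra.
have W0 : 0 < W by lra.
have := @cheeger R A V s (q [::]) F (eps / 2) s_bij _ _ _ isoF ps W
  (16 * (1 + n0) * z0) _ _ WE.
have Wbound a : a \in F -> (\esum_(v in [set: V])
    ((ps (s a v) - ps v) ^+ 2)%:E <= (16 * (1 + n0) * z0 * W)%:E)%E.
  move=> aF; apply: le_trans (D3 a aF) _; rewrite lee_fin.
  have -> : 2 * (z0 * M) + 2 * (n0 * (z0 * M)) = 2 * (1 + n0) * z0 * M by ring.
  have -> : 16 * (1 + n0) * z0 * W = 2 * (1 + n0) * z0 * (8 * W) by ring.
  apply: ler_wpM2l => //; apply: mulr_ge0; last exact: ltW.
  by apply: mulr_ge0 => //; apply: addr_ge0.
have qF : \sum_(a <- F) q [::] a <= 1.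
  by rewrite -lee_fin -(q_sum [::]) -sumEFin; exact: le_esum_fset.
move=> /(_ (fun a => ltW (q_gt0 [::] a)) qF) ch.
(* The left side is [eps^2 / 4], the right side at most [eps^2 / 5] by the choice of [z0]. *)
have : (eps / 2) ^+ 2 <= 4 * (16 * (1 + n0) * z0).
  have e2 : 0 < eps / 2 by rewrite divr_gt0.
  exact: (ch e2 (fun v => g0 _ _) W0 Wbound).
have := exprn_gt0 2 eps_gt0; rewrite !expr2; lra.
Qed.

End contraction_step.
End contraction.

(** * Decay and non-decay of the averaging operators *)

Section growth.
Context (R : realType) (A V : choiceType).
Variables (q : seq A -> A -> R) (s : A -> V -> V) (C r : R).
Hypothesis q_gt0 : forall u a, 0 < q u a.
Hypothesis q_sum : forall u, (\esum_(a in [set: A]) (q u a)%:E = 1)%E.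
Hypothesis C_gt0 : 0 < C.
Hypothesis r01 : 0 < r < 1.
Hypothesis q_holder : forall k u u' a, (k <= size u)%N -> (k <= size u')%N ->
  take k u = take k u' -> q u a <= expR (C * r ^+ k) * q u' a.
Hypothesis s_bij : forall a, bijective (s a).

Local Notation walk := (walk q s).
Local Notation walk_from h n := (iter n walk (fun=> EFin \o h)).

Lemma iter_walk_le n G (B : R) : 0 <= B -> (forall u v, (G u v <= B%:E)%E) ->
  forall u v, (iter n walk G u v <= B%:E)%E.
Proof.
move=> B0 GB u v; apply: le_trans (le_iter_walk s q_gt0 n GB u v) _.
by rewrite (iter_walk_cst s q_gt0 q_sum).
Qed.

Lemma walk_from_fin (h : V -> R) (B : R) n u v :
  (forall v, 0 <= h v <= B) ->
  walk_from h n u v = (fine (walk_from h n u v))%:E /\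
  0 <= fine (walk_from h n u v) <= B.
Proof.
move=> hB; have h0 v' : 0 <= h v' by case/andP: (hB v').
have hB' v' : h v' <= B by case/andP: (hB v').
have B0 : 0 <= B := le_trans (h0 v) (hB' v).
have : (0 <= walk_from h n u v)%E.
  by apply: (iter_walk_ge0 s q_gt0) => u' v'; rewrite lee_fin.
have : (walk_from h n u v <= B%:E)%E.
  by apply: iter_walk_le => // u' v'; rewrite lee_fin.
case: (walk_from h n u v) => [x|//|//]; rewrite !lee_fin /= => xB x0.
by rewrite x0 xB.
Qed.

(** A crude bound whose purpose is to make all iterates finite, so that they can be handled as real
    numbers. *)
Lemma envelope_bound (h : V -> R) (W : R) : (forall v, 0 <= h v) ->
  (\esum_(v in [set: V]) (h v ^+ 2)%:E <= W%:E)%E ->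
  forall v, 0 <= h v <= 1 + W.
Proof.
move=> h0 hW v; rewrite h0/=; have : h v ^+ 2 <= W.
  rewrite -lee_fin; apply: le_trans hW.
  exact: (@esum_ge_term R V setT (fun v => (h v ^+ 2)%:E) v).
have := sqr_ge0 (h v - 1 / 2); rewrite !expr2; lra.
Qed.

(** Jensen's inequality, read off from the variance identity along an arbitrary path by dropping the
    variance. *)
Lemma esum_walk_from_sqr (h : V -> R) (W : R) n u : (forall v, 0 <= h v) ->
  (\esum_(v in [set: V]) (h v ^+ 2)%:E <= W%:E)%E ->
  (\esum_(v in [set: V]) walk_from h n u v ^+ 2 <= W%:E)%E.
Proof.
move=> h0 hW; have hB := envelope_bound h0 hW.
have [c _] : exists c : A, True.
  apply/not_existsP => noA; have := q_sum [::]; rewrite esum1.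
    by move/eqP; rewrite eq_sym onee_eq0.
  by move=> a _; have := noA a.
pose f u v := fine (walk_from h n u v).
have fE u' v : walk_from h n u' v = (f u' v)%:E.
  by case: (walk_from_fin n u' v hB).
have h2 u' v : (0 <= ((fun (_ : seq A) v => (h v ^+ 2)%:E) u' v) :> \bar R)%E.
  by rewrite lee_fin sqr_ge0.
apply: le_trans (esum_iter_walk q_gt0 q_sum s_bij n u h2 (fun=> hW)).
apply: le_esum => v _; rewrite fE -EFin_expe.
have g0 (u' : seq A) v' : 0 <= (fun=> h) u' v' by [].
have := @iter_walk_variance R A V q s C r q_gt0 q_sum q_holder (nseq n c)
  (fun=> h) f u v g0.
rewrite size_nseq => /(_ (fE u v)); apply: le_trans.
rewrite lee_fin lerDl mulr_ge0 ?sqr_ge0// ltW//.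
exact: (path_weight_gt0 C q_gt0).
Qed.

(** [contraction_step] is applied to each iterate in turn; the regularity it requires is
    [iter_walk_holder], which does not deteriorate with the number of steps. *)
Lemma decay (eps : R) (J : {fset A}) : 0 < eps ->
  (forall K : {fset V}, K != fset0 ->
    ((eps * #|` K|%:R)%:E < walk_boundary q s K)%E) ->
  (forall v, exists2 a, a \in J & s a v = v) ->
  exists2 N : nat, (0 < N)%N & exists2 d : R, 0 < d < 1 &
  forall (h : V -> R) (W : R), (forall v, 0 <= h v) ->
  (\esum_(v in [set: V]) (h v ^+ 2)%:E <= W%:E)%E ->
  forall j u, (\esum_(v in [set: V]) walk_from h (N * j) u v ^+ 2 <=
    ((1 - d) ^+ j * W)%:E)%E.
Proof.
move=> eps0 bd loops.
have [m [d d01 step]] :=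
  contraction_step q_gt0 q_sum C_gt0 r01 q_holder s_bij eps0 bd loops.
exists m.+1 => //; exists d => // h W h0 hW.
have hB := envelope_bound h0 hW.
elim=> [|j IH] u.
  by rewrite muln0 expr0 mul1r.
pose f n u v := fine (walk_from h n u v).
have fE n u' v : walk_from h n u' v = (f n u' v)%:E.
  by case: (@walk_from_fin h (1 + W) n u' v hB).
have f0 n u' v : 0 <= f n u' v.
  by case: (@walk_from_fin h (1 + W) n u' v hB) => _ /andP[].
rewrite exprS -mulrA; under eq_esum do rewrite fE -EFin_expe.
apply: (step (f (m.+1 * j)%N)) => //.
- have h0e v : (0 <= (EFin \o h) v)%E by rewrite lee_fin.
  move=> k u1 u2 v k1 k2 u12; rewrite -lee_fin EFinM -!fE.
  apply: (iter_walk_holder s q_gt0 C_gt0 r01 q_holder) => //.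
- move=> u1 v; rewrite -fE mulnS iterD; congr (iter _ _ _ _ _).
  by apply/funext => u2; apply/funext => v2; rewrite fE.
- by move=> u1; have := IH u1; under eq_esum do rewrite fE -EFin_expe.
Qed.

(** The first step either leaves [K], which costs the boundary weight up to [expR C], or moves to a
    point of [K]. For a fixed letter the latter points are distinct, so the induction hypothesis
    applies to their sum. *)
Lemma walk_escape (K : {fset V}) n u :
  (\sum_(v <- K) iter n walk (fun _ v => (v \notin K)%:R%:E) u v <=
   (n%:R * expR C)%:E * walk_boundary q s K)%E.
Proof.
have q0 u' a : 0 <= q u' a by rewrite ltW.
have i0 v : (0 <= (v \notin K)%:R%:E :> \bar R)%E by rewrite lee_fin ler0n.
have wb0 : (0 <= walk_boundary q s K)%E.
  apply: sume_ge0 => v _; apply: esum_ge0 => a _.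
  by rewrite lee_fin mulr_ge0.
have wb_lt : (walk_boundary q s K < +oo)%E.
  apply: (@le_lt_trans _ _ (\sum_(v <- K) 1%:E)%E); last by rewrite sumEFin ltry.
  apply: lee_sum => v _; rewrite -(q_sum [::]); apply: le_esum => a _.
  by rewrite lee_fin ler_piMr//; case: (_ \notin _).
elim: n u => [|n IH] u.
  rewrite mul0r mul0e big_seq big1//= => v ->//.
rewrite iterS {1}/walk.
set G := iter n walk _ in IH *.
have G0 u' v : (0 <= G u' v)%E by apply: (iter_walk_ge0 s q_gt0).
have G1 u' v : (G u' v <= 1)%E.
  by apply: iter_walk_le => // _ v'; rewrite lee_fin; case: (_ \notin _).
rewrite -esum_sum; last by move=> a v _ _; rewrite mule_ge0// lee_fin.
apply: (@le_trans _ _ (\esum_(a in [set: A]) ((q u a)%:E *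
    ((n%:R * expR C)%:E * walk_boundary q s K) +
   (expR C)%:E * (\sum_(v <- K) (q [::] a * (s a v \notin K)%:R)%:E)))%E).
  apply: le_esum => a _.
  rewrite -ge0_sume_distrr//.
  apply: (@le_trans _ _ ((q u a)%:E * (\sum_(v <- K) G (a :: u) v) +
      (q u a)%:E * \sum_(v <- K) (s a v \notin K)%:R%:E)%E).
    rewrite -ge0_muleDr; [|exact: sume_ge0..].
    apply: lee_wpmul2l; first by rewrite lee_fin.
    apply: (@le_trans _ _ (\sum_(v <- K | s a v \in K) G (a :: u) (s a v) +
        \sum_(v <- K) (s a v \notin K)%:R%:E)%E).
      rewrite [X in (_ <= X + _)%E]big_mkcond -big_split/=; apply: lee_sum => v _.
      by case: (s a v \in K); rewrite ?adde0 ?add0e.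
    apply: leeD => //.
    pose K' := [fset s a v | v in [fset v in K | s a v \in K]]%fset.
    have -> : (\sum_(v <- K | s a v \in K) G (a :: u) (s a v) =
        \sum_(v <- K') G (a :: u) v)%E.
      rewrite big_imfset/=; last by move=> x y _ _; apply: bij_inj.
      by rewrite big_fset.
    have K'K : (K' `<=` K)%fset.
      by apply/fsubsetP => _ /imfsetP[v /= + ->]; rewrite !inE/= => /andP[].
    rewrite [leRHS](big_fsetID _ (mem K'))/=.
    have -> : [fset x | x in K & x \in K']%fset = K'.
      apply/fsetP => x; rewrite !inE/=; case: (boolP (x \in K')) => xK'.
        by rewrite (fsubsetP K'K).
      by rewrite andbF.
    by apply: leeDl; exact: sume_ge0.
  apply: leeD; first by rewrite lee_wpmul2l ?lee_fin// IH.
  rewrite !sumEFin -!EFinM lee_fin -mulr_sumr mulrA.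
  rewrite ler_wpM2r ?sumr_ge0//; exact: (q_le_nil q_holder).
rewrite esumD; last 2 first.
- by move=> a _; rewrite !mule_ge0 ?lee_fin// mulr_ge0 ?expR_ge0.
- move=> a _; rewrite mule_ge0 ?lee_fin ?expR_ge0// sume_ge0// => v _.
  by rewrite lee_fin mulr_ge0.
rewrite esumZl ?expR_ge0//; last first.
  by move=> a _; rewrite sume_ge0// => v _; rewrite lee_fin mulr_ge0.
rewrite esum_sum; last by move=> a v _ _; rewrite lee_fin mulr_ge0.
rewrite -/(walk_boundary q s K).
have -> : (\esum_(a in [set: A]) ((q u a)%:E *
    ((n%:R * expR C)%:E * walk_boundary q s K)) =
    (n%:R * expR C)%:E * walk_boundary q s K)%E.
  case: (walk_boundary q s K) wb0 wb_lt => [x x0 _|//|//].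
  rewrite -EFinM; under eq_esum do rewrite muleC.
  rewrite esumZl ?q_sum ?mule1//; first by rewrite !mulr_ge0 ?expR_ge0.
  by move=> a _; rewrite lee_fin.
rewrite -ge0_muleDl ?lee_fin ?expR_ge0 ?mulr_ge0 ?expR_ge0//.
by rewrite -EFinD -[X in (_ + X)%R]mul1r -mulrDl -natr1.
Qed.

(** The mass lost by the indicator of [K] is what the indicator of the complement sends into [K],
    hence at most a quarter of the size of [K]. *)
Lemma nondecay (K : {fset V}) (e : R) n u :
  (walk_boundary q s K <= (e * #|` K|%:R)%:E)%E -> n%:R * expR C * e <= 1 / 4 ->
  ((#|` K|%:R / 2)%:E <= \esum_(v in [set: V])
    walk_from (fun v => (v \in K)%:R) n u v ^+ 2)%E.
Proof.
move=> Ke ne.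
set h : V -> R := fun v => (v \in K)%:R.
have hB v : 0 <= h v <= 1 by rewrite /h; case: (v \in K); rewrite ?lexx ler01.
pose f v := fine (walk_from h n u v).
have fE v : walk_from h n u v = (f v)%:E by case: (walk_from_fin n u v hB).
have esc := @walk_escape K n u.
have gE v : iter n walk (fun _ v => (v \notin K)%:R%:E) u v = (1 - f v)%:E.
  have := @iter_walkD R A V q s q_gt0 n (fun=> EFin \o h)
    (fun _ v => (v \notin K)%:R%:E).
  have -> : (fun u v => ((EFin \o h) v + (v \notin K)%:R%:E)%E) =
      (fun (_ : seq A) (_ : V) => 1%:E).
    apply/funext => u'; apply/funext => v'; rewrite /h /= -EFinD.
    by case: (v' \in K); rewrite ?addr0 ?add0r.
  rewrite (iter_walk_cst s q_gt0 q_sum)//.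
  have h0 (u' : seq A) v' : (0 <= (EFin \o h) v')%E by rewrite lee_fin ler0n.
  have h1 (u' : seq A) v' : (0 <= (v' \notin K)%:R%:E :> \bar R)%E.
    by rewrite lee_fin ler0n.
  move=> /(_ h0 h1)/(congr1 (fun G => G u v)) /= D.
  by rewrite EFinB D fE addeAC subee ?add0e.
apply: (@le_trans _ _ (\sum_(v <- K) (f v ^+ 2)%:E)%E); last first.
  under [leRHS]eq_esum do rewrite fE -EFin_expe.
  exact: le_esum_fset.
rewrite sumEFin lee_fin.
move: esc; under eq_bigr do rewrite gE.
rewrite sumEFin => esc.
have {}esc : \sum_(v <- K) (1 - f v) <= 1 / 4 * #|` K|%:R.
  rewrite -lee_fin; apply: (le_trans esc).
  apply: (@le_trans _ _ ((n%:R * expR C)%:E * (e * #|` K|%:R)%:E)%E).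
    by rewrite lee_wpmul2l// lee_fin mulr_ge0 ?expR_ge0.
  by rewrite -EFinM lee_fin mulrA ler_wpM2r.
have -> : #|` K|%:R / 2 = 3 / 4 * #|` K|%:R - 1 / 4 * #|` K|%:R :> R by field.
have cardE (c : R) : c * #|` K|%:R = \sum_(v <- K) c.
  by rewrite card_fset_sum1 natr_sum mulr_sumr; apply: eq_bigr => v _; rewrite mulr1.
(* The tangent line bound [f^2 >= f - 1/4] turns the estimate for the sum of [f] into one for its
   squares. *)
apply: (@le_trans _ _ (\sum_(v <- K) (1 - 1 / 4 - (1 - f v)))).
  by rewrite sumrB -cardE lerB// ler_wpM2r//; lra.
by apply: ler_sum => v _; have := sqr_ge0 (f v - 1 / 2); rewrite !expr2; lra.
Qed.

End growth.

(** * Measures of cylinders *)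

Section countable_extra.
Context (R : realType) (T : pcountType).

Lemma esum_pickle (f : T -> \bar R) : (forall t, 0 <= f t)%E ->
  (\esum_(t in [set: T]) f t =
   \sum_(n <oo) oapp f 0 (choice.pickle_inv n : option T))%E.
Proof.
move=> f0; rewrite nneseries_esumT; last by move=> n; case: choice.pickle_inv.
rewrite [RHS](_ : _ = \esum_(n in range (@choice.pickle T))
    oapp f 0 (choice.pickle_inv n : option T))%E; last first.
  rewrite [RHS]esum_mkcond; apply: eq_esum => n _; case: ifPn => // nT.
  case E : (choice.pickle_inv n : option T) => [t|//]; move: nT; rewrite notin_setE.
  case; exists t => //; have := @choice.pickle_invK T n.
  by rewrite /= E /=.
rewrite esum_image; last first.
  by move=> x y _ _; exact: (pcan_inj (@choice.pickleK_inv T)).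
by apply: eq_esum => t _; rewrite choice.pickleK_inv.
Qed.

Lemma bigcup_pickle (U : Type) (F : T -> set U) :
  \bigcup_t F t = \bigcup_n oapp F set0 (choice.pickle_inv n : option T).
Proof.
apply/seteqP; split => x [t _ Ftx].
  by exists (choice.pickle t) => //; rewrite choice.pickleK_inv.
by case: (choice.pickle_inv t : option T) Ftx => //= t' Ft'x; exists t'.
Qed.

Lemma countable_bigcup_measurable d (U : measurableType d) (F : T -> set U) :
  (forall t, measurable (F t)) -> measurable (\bigcup_t F t).
Proof.
move=> mF; rewrite bigcup_pickle; apply: bigcupT_measurable => n.
by case: choice.pickle_inv => [t|] //=.
Qed.

Lemma measure_countable_bigcup d (U : measurableType d)
    (m : {measure set U -> \bar R}) (F : T -> set U) :
  (forall t, measurable (F t)) -> trivIset setT F ->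
  (m (\bigcup_t F t) = \esum_(t in [set: T]) m (F t))%E.
Proof.
move=> mF tF; rewrite bigcup_pickle measure_bigcup//; last 2 first.
- by move=> n _; case: choice.pickle_inv => [t|] //=.
- move=> i j _ _ [x []].
  case Ei : (choice.pickle_inv i : option T) => [t|//] /= tx.
  case Ej : (choice.pickle_inv j : option T) => [t'|//] /= t'x.
  have tt' : t = t' by apply: tF => //; exists x.
  have := @choice.pickle_invK T i; rewrite /= Ei /= => <-.
  by have := @choice.pickle_invK T j; rewrite /= Ej /= => <-; rewrite tt'.
rewrite esum_pickle// (@eq_eseriesl _ _ xpredT).
  by apply: eq_eseriesr => n _; case: (choice.pickle_inv n : option T) => [t|] /=.
by move=> n; rewrite in_setT.
Qed.

Lemma ae_countable d (U : measurableType d) (m : {measure set U -> \bar R})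
    (P : T -> U -> Prop) :
  (forall t, \forall x \ae m, P t x) -> \forall x \ae m, forall t, P t x.
Proof.
move=> mP.
have : \forall x \ae m, forall n,
    oapp (fun t => P t x) True (choice.pickle_inv n : option T).
  apply: ae_foralln => n; case: (choice.pickle_inv n : option T) => [t|] //=.
  exact: aeW.
apply: filterS => x Px t.
by have := Px (choice.pickle t); rewrite choice.pickleK_inv.
Qed.

End countable_extra.

(** A null set of the product has null sections over almost every point. *)
Lemma ae_prod d d' (R : realType) (X : measurableType d) (Y : measurableType d')
    (m : {sigma_finite_measure set X -> \bar R})
    (m' : {sigma_finite_measure set Y -> \bar R}) (P : X * Y -> Prop) :
  (\forall z \ae (m \x m')%E, P z) ->
  \forall x \ae m, \forall y \ae m', P (x, y).
Proof.
move=> [N [mN N0 PN]].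
have mx : measurable_fun [set: X] ((m' \o xsection N) : X -> \bar R).
  exact: measurable_fun_xsection.
have : (\int[m]_x `|(m' \o xsection N) x| = 0)%E.
  by rewrite -[RHS]N0; apply: eq_integral => x _; rewrite gee0_abs.
move/(ae_eq_integral_abs _ measurableT mx); apply: filterS => x /= /(_ I) Nx.
exists (xsection N x); split => //; first exact: measurable_xsection.
move=> y /= nP; rewrite /xsection/= inE; exact: PN.
Qed.

Section cylinder_mass.
Context (R : realType) (A : pcountType).
Local Notation X := (seq_space A).
Variable mu : probability X R.

Lemma tau_cylinder (w u : seq A) : tau w @` cylinder u = cylinder (w ++ u).
Proof.
elim: w => [|a w IH]; first by rewrite image_id.
have -> : tau (a :: w) @` cylinder u = tau [:: a] @` (tau w @` cylinder u).
  by rewrite -image_comp.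
rewrite IH cat_cons; move: (w ++ u) => {IH} {u} {}w.
rewrite /tau /=; apply/seteqP; split => [_ [x /= xw <-]|x].
  rewrite /cylinder /= /mkseq /= (iotaDl 1 0) -map_comp; congr cons.
  exact: xw.
rewrite /cylinder /= /mkseq /= (iotaDl 1 0) -map_comp => -[xa xw].
by exists (theta x) => //; apply/funext => -[|n] /=.
Qed.

Lemma cylinder_nil : cylinder [::] = [set: X].
Proof. by apply/seteqP; split. Qed.

Lemma mkseq_scons (a : A) (x : X) k : mkseq (scons a x) k.+1 = a :: mkseq x k.
Proof. by rewrite /mkseq /= (iotaDl 1 0) -map_comp. Qed.

Definition mass (w : seq A) : R := fine (mu (cylinder w)).

(** For an invariant measure this is the conditional probability that the first letter is [a], given
    that the shifted sequence starts with [u]. *)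
Definition letter_weight (u : seq A) (a : A) : R := mass (a :: u) / mass u.

Lemma massE w : (mass w)%:E = mu (cylinder w).
Proof. by rewrite fineK// fin_num_measure//; exact: measurable_cylinder. Qed.

Lemma mass_nil : mass [::] = 1.
Proof. by apply: EFin_inj; rewrite massE cylinder_nil probability_setT. Qed.

Lemma letter_weight_nil a : letter_weight [::] a = mass [:: a].
Proof. by rewrite /letter_weight mass_nil divr1. Qed.

Lemma measurable_coord0 (P : A -> Prop) : measurable [set x : X | P (x 0%N)].
Proof.
have -> : [set x : X | P (x 0%N)] =
    \bigcup_a (if `[< P a >] then cylinder [:: a] else set0 : set X).
  apply/seteqP; split => [x Px|x [a _]].
    by exists (x 0%N) => //; case: asboolP.
  by case: asboolP => // Pa [xa]; rewrite /= xa.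
apply: countable_bigcup_measurable => a; case: ifP => // _.
exact: measurable_cylinder.
Qed.

Lemma mu_coord0 (P : A -> Prop) : (mu [set x : X | P (x 0%N)] =
  \esum_(a in [set: A]) (letter_weight [::] a * `[< P a >]%:R)%:E)%E.
Proof.
have -> : [set x : X | P (x 0%N)] =
    \bigcup_a (if `[< P a >] then cylinder [:: a] else set0 : set X).
  apply/seteqP; split => [x Px|x [a _]].
    by exists (x 0%N) => //; case: asboolP.
  by case: asboolP => // Pa [xa]; rewrite /= xa.
rewrite measure_countable_bigcup; last 2 first.
- by move=> a; case: ifP => // _; exact: measurable_cylinder.
- move=> a b _ _ [x []]; by case: ifP => // _ [<-]; case: ifP => // _ [<-].
apply: eq_esum => a _; rewrite letter_weight_nil.
by case: asboolP => _; rewrite ?measure0 ?mulr0// mulr1 massE.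
Qed.

Section invariant.
Hypothesis mu_inv : theta_invariant mu.
Hypothesis mass_gt0 : forall w, 0 < mass w.

Lemma letter_weight_gt0 u a : 0 < letter_weight u a.
Proof. by rewrite divr_gt0. Qed.

(** The cylinders of [a :: u] partition the preimage of the cylinder of [u] under the shift, which
    has the same mass by invariance. *)
Lemma letter_weight_sum u :
  (\esum_(a in [set: A]) (letter_weight u a)%:E = 1)%E.
Proof.
have E : (\esum_(a in [set: A]) (mass (a :: u))%:E = (mass u)%:E)%E.
  rewrite massE -mu_inv; last exact: measurable_cylinder.
  have -> : @theta A @^-1` cylinder u = \bigcup_a cylinder (a :: u).
    apply/seteqP; split => [x xu|x [a _]].
      exists (x 0%N) => //; rewrite /cylinder /= /mkseq /= (iotaDl 1 0) -map_comp.
      by congr cons; exact: xu.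
    by rewrite /cylinder /= /mkseq /= (iotaDl 1 0) -map_comp => -[_].
  rewrite measure_countable_bigcup; last 2 first.
  - by move=> a; exact: measurable_cylinder.
  - move=> a b _ _ [x []]; rewrite /cylinder /= /mkseq /= => -[<- _] [<- _].
    by [].
  by apply: eq_esum => a _; rewrite massE.
rewrite /letter_weight; under eq_esum do rewrite mulrC EFinM.
rewrite esumZl; last 2 first.
- by rewrite invr_ge0 ltW.
- by move=> a _; rewrite lee_fin ltW.
by rewrite E -EFinM mulVf// gt_eqF.
Qed.

End invariant.
End cylinder_mass.

(** * Regular points *)

Section regular_points.
Context (R : realType) (A : pcountType).
Local Notation X := (seq_space A).
Variable mu : probability X R.

Lemma continuous_scons (a : A) :
  continuous (scons a : seq_topology A -> seq_topology A).
Proof.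
move=> x.
have F : Filter (nbhs x) by exact: nbhs_filter.
have F2 : Filter (fmap (scons a : seq_topology A -> seq_topology A) (nbhs x)).
  exact: fmap_filter.
apply/(cvg_sup _ _ F2) => i Q /= [_ [[B Bop <-] Bx] BQ].
case: i Bx BQ => [|i] Bx BQ.
  rewrite /nbhs /=; apply: (@filterS _ _ F setT) => [y _|]; first exact: BQ.
  exact: filterT.
have nB : nbhs (x i : discrete_topology A) B by apply: open_nbhs_nbhs.
have := @Defs.coord_continuous _ i x _ nB.
by rewrite /nbhs /=; apply: (@filterS _ _ F) => y By; exact: BQ.
Qed.

Lemma measurable_scons (a : A) : measurable_fun [set: X] (scons a : X -> X).
Proof.
apply: (@measurability _ _ X X setT (scons a) (@open (seq_topology A))) => //.
move=> _ [B oB <-]; rewrite setTI; apply: sub_sigma_algebra.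
by apply: open_comp oB => x _; exact: continuous_scons.
Qed.

Definition branch (a : A) (x : X) : R := fine (phi mu [:: a] x).

(** The Hoelder condition concerns almost all pairs of points; averaging the second point over a
    cylinder around the first leaves this condition on a single point. *)
Definition regular (C r : R) (x : X) := forall a k,
  [/\ 0 < branch a x,
      branch a x <= expR (C * r ^+ k) * letter_weight mu (mkseq x k) a &
      letter_weight mu (mkseq x k) a <= expR (C * r ^+ k) * branch a x].

Hypothesis mu_inv : theta_invariant mu.
Hypothesis mu_holder : log_holder mu.

Lemma mass_gt0 w : 0 < mass mu w.
Proof. by case: mu_holder => cyl _ _ _; rewrite -lte_fin massE. Qed.

Lemma measurable_phi w : measurable_fun [set: X] (phi mu w).
Proof.
case: mu_holder => _ dom _ _.
have nu_mu : charge_of_finite_measure (mu_tau mu w) `<< mu := dom w.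
exact: (measurable_int _ (Radon_Nikodym_integrable nu_mu)).
Qed.

(** The absolute value makes the density nonnegative everywhere instead of almost everywhere, as
    comparisons of integrals require. *)
Lemma mu_tau_integral w (B : set X) : measurable B ->
  (mu (tau w @` B) = \int[mu]_(x in B) `|phi mu w x|)%E.
Proof.
case: mu_holder => _ dom pos _ mB.
transitivity (\int[mu]_(x in B) phi mu w x)%E.
  have nu_mu : charge_of_finite_measure (mu_tau mu w) `<< mu := dom w.
  exact: (Radon_Nikodym_integral nu_mu mB).
apply: ae_eq_integral => //.
- exact: measurable_funTS (measurable_phi w).
- by apply: measurableT_comp => //; exact: measurable_funTS (measurable_phi w).
by apply: filterS (pos w) => x /andP[x0 _] _; rewrite gee0_abs// ltW.
Qed.

(** If [B] is the preimage of a null set under [scons a], the density integrates to 0 over [B];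
    being positive almost everywhere, it forces [B] to be null. This allows almost sure bounds to be
    used at the preimages [ax]. *)
Lemma ae_scons (P : X -> Prop) : (\forall x \ae mu, P x) ->
  \forall x \ae mu, forall a, P (scons a x).
Proof.
move=> [M [mM M0 PM]]; apply: ae_countable => a.
case: mu_holder => _ dom pos _.
pose B := scons a @^-1` M.
have mB : measurable B.
  by rewrite -[B]setTI; exact: (measurable_scons a measurableT mM).
have : (\int[mu]_(x in B) `|phi mu [:: a] x| = 0)%E.
  rewrite -(mu_tau_integral [:: a])//; apply: (subset_measure0 _ mM) => //.
    exact: measurable_tau_image.
  by move=> _ [x Bx <-].
move/(ae_eq_integral_abs _ mB).
move=> /(_ (measurable_funTS (measurable_phi _))) phiB.
have phi0 : \forall x \ae mu, B x -> phi mu [:: a] x = 0%E by exact: phiB.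
move: phi0 (pos [:: a]); apply: filterS2 => x Bx0 /andP[x0 _].
apply: contrapT => nP; have Bx : B x by apply: PM.
by move: x0; rewrite Bx0// ltxx.
Qed.

(** The pointwise comparison of [branch a x] with [branch a y] is integrated over [y] in the
    cylinder [u], where the density has integral [mass mu (a :: u)]. *)
Lemma branch_bounds (C r : R) (a : A) (x : X) k : 0 < C -> 0 < r < 1 ->
  0 < branch a x ->
  (\forall y \ae mu, `|ln (branch a x) - ln (branch a y)| <=
     C * dist_r r x y) ->
  branch a x <= expR (C * r ^+ k) * letter_weight mu (mkseq x k) a /\
  letter_weight mu (mkseq x k) a <= expR (C * r ^+ k) * branch a x.
Proof.
move=> C0 /andP[r0 r1] x0 xy; set u := mkseq x k; set e := expR _.
case: mu_holder => _ dom pos _.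
have near_y : \forall y \ae mu, cylinder u y ->
    (((branch a x)%:E <= e%:E * `|phi mu [:: a] y|) /\
     (`|phi mu [:: a] y| <= (e * branch a x)%:E))%E.
  move: xy (pos [:: a]); apply: filterS2 => y + /andP[y0 yoo] yu.
  have yE : (`|phi mu [:: a] y| = (branch a y)%:E)%E.
    rewrite gee0_abs ?ltW// /branch fineK//.
    by rewrite ge0_fin_numE ?ltW.
  have y0' : 0 < branch a y by rewrite -lte_fin -yE gee0_abs// ltW.
  rewrite yE -EFinM !lee_fin.
  have dr : dist_r r x y <= r ^+ k.
    rewrite /dist_r; case: pselect => [ne|_]; last by rewrite exprn_ge0// ltW.
    case: ex_minnP => m xym _; apply: ler_wiXn2l; rewrite ?ltW//.
    rewrite leqNgt; apply/negP => mk; move/eqP: xym; apply.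
    have := congr1 (fun s => nth point s m) yu.
    by rewrite !nth_mkseq ?size_mkseq.
  move=> /le_trans /(_ (ler_wpM2l (ltW C0) dr)).
  rewrite ler_norml lerBlDr lerBrDr => /andP[h1 h2]; split.
    by rewrite -ler_ln ?posrE ?mulr_gt0 ?expR_gt0// lnM ?posrE ?expR_gt0// expRK.
  rewrite -ler_ln ?posrE ?mulr_gt0 ?expR_gt0// lnM ?posrE ?expR_gt0// expRK; lra.
have mu_u := massE mu u.
have u0 := mass_gt0 u.
have mcyl := measurable_cylinder u.
have int_phi : (\int[mu]_(y in cylinder u) `|phi mu [:: a] y| =
    (mass mu (a :: u))%:E)%E.
  by rewrite -mu_tau_integral// tau_cylinder massE.
have mphi : measurable_fun (cylinder u) (fun y => `|phi mu [:: a] y|)%E.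
  by apply: measurableT_comp => //; exact: measurable_funTS (measurable_phi _).
rewrite /letter_weight; split.
  rewrite mulrA ler_pdivlMr// -lee_fin.
  rewrite EFinM [leRHS]EFinM mu_u -int_phi -integral_cst//.
  rewrite -ge0_integralZl//; last first.
    by rewrite lee_fin expR_ge0.
  apply: ae_ge0_le_integral => //.
  - by move=> y _; rewrite lee_fin ltW.
  - by move=> y _; rewrite mule_ge0// lee_fin expR_ge0.
  - exact: measurable_funeM.
  - by apply: filterS near_y => y h yu; case: (h yu).
rewrite ler_pdivrMr// -lee_fin [leRHS]EFinM mu_u -int_phi -integral_cst//.
apply: ae_ge0_le_integral => //.
- by move=> y _; rewrite lee_fin mulr_ge0 ?expR_ge0// ltW.
- by apply: filterS near_y => y h yu; case: (h yu).
Qed.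

Lemma exists_regular : exists C r : R, [/\ 0 < C, 0 < r < 1 &
  \forall x \ae mu, regular C r x].
Proof.
case: mu_holder => _ _ pos [C [r [C0 r01 hol]]].
exists C, r; split => //.
apply: ae_countable => a.
move: (ae_prod (hol [:: a])) (pos [:: a]).
apply: filterS2 => x xy /andP[x0 xoo] k.
have bx0 : 0 < branch a x by rewrite fine_gt0// x0 xoo.
by have [] := branch_bounds k C0 r01 bx0 xy.
Qed.

(** Both weights are compared with the one of the common prefix. Each comparison passes through the
    branch at a regular point of the cylinder and costs [2 * C]. *)
Lemma letter_weight_holder (C r : R) : 0 < C -> 0 < r < 1 ->
  (\forall x \ae mu, regular C r x) ->
  forall k u u' a, (k <= size u)%N -> (k <= size u')%N ->
  take k u = take k u' ->
  letter_weight mu u a <= expR (4 * C * r ^+ k) * letter_weight mu u' a.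
Proof.
move=> C0 /andP[r0 r1] reg.
have pt u : exists2 x, cylinder u x & regular C r x.
  apply: contrapT => no.
  have : mu.-negligible (cylinder u).
    case: reg => N [mN N0 regN]; exists N; split => // x ux.
    by apply: regN => rx; apply: no; exists x.
  move/(measure_negligible (measurable_cylinder u)) => u0.
  by have := mass_gt0 u; rewrite -lte_fin massE u0 ltxx.
have two k u a : (k <= size u)%N ->
    letter_weight mu u a <= expR (2 * C * r ^+ k) * letter_weight mu (take k u) a /\
    letter_weight mu (take k u) a <= expR (2 * C * r ^+ k) * letter_weight mu u a.
  move=> ku; have [x xu rx] := pt u.
  have [_ h1 h2] := rx a k; have [b0 h3 h4] := rx a (size u).
  rewrite xu in h3 h4.
  have E : mkseq x k = take k u.
    by rewrite -[in RHS]xu /mkseq -map_take take_iota (minn_idPl ku).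
  rewrite E in h1 h2.
  have rk : r ^+ size u <= r ^+ k by rewrite ler_wiXn2l ?ltW.
  have e1 : expR (C * r ^+ size u) <= expR (C * r ^+ k).
    by rewrite ler_expR ler_pM2l.
  have e0 := expR_ge0 (C * r ^+ k).
  have -> : expR (2 * C * r ^+ k) = expR (C * r ^+ k) * expR (C * r ^+ k).
    by rewrite -expRD; congr expR; ring.
  have lw w b : 0 <= letter_weight mu w b.
    by rewrite ltW// letter_weight_gt0//; exact: mass_gt0.
  split; rewrite -mulrA.
    apply: (le_trans h4); by rewrite ler_pM// ?expR_ge0// ltW.
  apply: (le_trans h2); rewrite ler_wpM2l//; apply: (le_trans h3).
  by rewrite ler_wpM2r.
move=> k u u' a ku ku' uu'.
have [h1 _] := two k u a ku; have [_ h2] := two k u' a ku'.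
apply: (le_trans h1); rewrite uu'.
have -> : expR (4 * C * r ^+ k) = expR (2 * C * r ^+ k) * expR (2 * C * r ^+ k).
  by rewrite -expRD; congr expR; ring.
by rewrite -[leRHS]mulrA ler_wpM2l// expR_ge0.
Qed.

(** Comparison with letter weights, which sum to 1, shows that the sum is 1 up to the factor
    [expR (C * r ^+ k)], for every [k]. In other words, the transfer operator fixes the constant
    1. *)
Lemma branch_sum (C r : R) x : 0 < C -> 0 < r < 1 -> regular C r x ->
  (\esum_(a in [set: A]) (branch a x)%:E = 1)%E.
Proof.
move=> C0 r01 reg.
have bnd k : (\esum_(a in [set: A]) (branch a x)%:E <= (expR (C * r ^+ k))%:E /\
    1 <= (expR (C * r ^+ k))%:E * \esum_(a in [set: A]) (branch a x)%:E)%E.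
  rewrite -esumZl ?expR_ge0//; last first.
    by move=> a _; rewrite lee_fin; case: (reg a 0%N) => /ltW.
  have sum1 := letter_weight_sum mu_inv mass_gt0 (mkseq x k).
  split.
    rewrite -[leRHS]mule1 -[X in (_ * X)%E]sum1 -esumZl ?expR_ge0//; last first.
      by move=> a _; rewrite lee_fin ltW// letter_weight_gt0//; exact: mass_gt0.
    by apply: le_esum => a _; rewrite -EFinM lee_fin; case: (reg a k).
  rewrite -[leLHS]sum1; apply: le_esum => a _.
  by rewrite -EFinM lee_fin; case: (reg a k).
have small e : 0 < e -> exists k, expR (C * r ^+ k) <= 1 + e.
  move=> e0; have [|k rk] := @exists_expr_lt R r (Num.min (1 / 2) (e / 2) / C) r01.
    by rewrite divr_gt0// lt_min; apply/andP; split; lra.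
  exists k; move: rk; rewrite ltr_pdivlMr// mulrC lt_min => /andP[k1 k2].
  have x0 : 0 <= C * r ^+ k.
    case/andP: r01 => r0 _.
    by apply: mulr_ge0; [exact: ltW|apply: exprn_ge0; exact: ltW].
  by have := expR_sub1_le x0 (ltW k1); lra.
case: (\esum_(a in [set: A]) (branch a x)%:E)%E bnd => [b bnd|bnd|bnd].
- have {}bnd k : b <= expR (C * r ^+ k) /\ 1 <= expR (C * r ^+ k) * b.
    by have := bnd k; rewrite -EFinM !lee_fin.
  have b0 : 0 < b.
    have [_] := bnd 0%N; rewrite ltNge => h; apply/negP => b0.
    by have := le_trans h (mulr_ge0_le0 (expR_ge0 _) b0); rewrite ler10.
  congr EFin; apply/eqP; rewrite eq_le.
  apply/andP; split; apply/ler_addgt0Pr => e e0.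
    have [k ke] := small e e0; have [h _] := bnd k; exact: le_trans ke.
  have eb : 0 < e / b by rewrite divr_gt0.
  have [k ke] := small _ eb; have [_ h] := bnd k.
  apply: (le_trans h); have := ler_wpM2r (ltW b0) ke.
  by rewrite mulrDl mul1r divfK ?gt_eqF.
- by have [] := bnd 0%N; rewrite leye_eq.
- by have [_] := bnd 0%N; rewrite gt0_muleNy ?lte_fin ?expR_gt0// leeNy_eq.
Qed.

End regular_points.

(** * Bounds for the iterated transfer operator *)

Section transfer_bounds.
Context (R : realType) (A V : pcountType).
Local Notation X := (seq_space A).
Local Notation VV := (vertices V).
Variables (mu : probability X R) (kappa : X -> V -> V).
Hypothesis mu_inv : theta_invariant mu.
Hypothesis mu_holder : log_holder mu.
Variable s : A -> V -> V.
Hypothesis kappa_s : forall x v, kappa x (s (x 0%N) v) = v.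
Hypothesis s_kappa : forall x v, s (x 0%N) (kappa x v) = v.
Variables (C r : R).
Hypothesis C_gt0 : 0 < C.
Hypothesis r01 : 0 < r < 1.
Hypothesis ae_regular : \forall x \ae mu, regular mu C r x.

Local Notation q := (letter_weight mu).
Local Notation T := (transfer mu kappa).
Local Notation walk := (walk q s).
Local Notation walk_from h n := (iter n walk (fun=> EFin \o h)).

Lemma skew_fiber (x : X) (v : V) :
  skew_product kappa @^-1` [set ((x, v) : X * VV)] =
  [set ((scons a x, s a v) : X * VV) | a in [set: A]].
Proof.
apply/seteqP; split => [[y w] /= [yx yw]|_ [a _ <-]].
  exists (y 0%N) => //; rewrite -yx -yw s_kappa; congr pair.
  by apply/funext => -[|n].
rewrite /skew_product /=; congr pair.
by have := kappa_s (scons a x) v; rewrite /=.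
Qed.

Lemma esum_fiber (F : X * VV -> \bar R) x v :
  (\esum_(y in skew_product kappa @^-1` [set ((x, v) : X * VV)]) F y =
   \esum_(a in [set: A]) F (scons a x, s a v))%E.
Proof.
rewrite skew_fiber esum_image// => a b _ _ [ab _].
by have := congr1 (@^~ 0%N) ab.
Qed.

Lemma transferE (g : X * VV -> R) x v : T g (x, v) =
  fine (\esum_(a in [set: A])
          maxe (branch mu a x * g (scons a x, s a v))%:E 0 -
        \esum_(a in [set: A])
          maxe (- (branch mu a x * g (scons a x, s a v))%:E) 0)%E.
Proof.
rewrite /transfer !esum_fiber; congr (fine (_ - _)%E); apply: eq_esum => a _.
  by rewrite funeposE.
by rewrite funenegE.
Qed.

(** No summability is asked: [fine] sends infinite values to 0, and then the right-hand side is
    infinite. *)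
Lemma transfer_le (g : X * VV -> R) x v : regular mu C r x ->
  (`|T g (x, v)|%:E <= \esum_(a in [set: A])
     ((branch mu a x)%:E * `|g (scons a x, s a v)|%:E))%E.
Proof.
move=> reg; have b0 a : 0 <= branch mu a x by case: (reg a 0%N) => /ltW.
rewrite transferE.
set G := fun a => (branch mu a x * g (scons a x, s a v)).
have max0 (y : \bar R) : (0 <= maxe y 0)%E by rewrite le_max lexx orbT.
have -> : (\esum_(a in [set: A])
     ((branch mu a x)%:E * `|g (scons a x, s a v)|%:E) =
   \esum_(a in [set: A]) maxe (G a)%:E 0 +
   \esum_(a in [set: A]) maxe (- (G a)%:E) 0)%E.
  rewrite -esumD//; apply: eq_esum => a _.
  rewrite -EFinM -(ger0_norm (b0 a)) -normrM -/(G a).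
  rewrite -EFinN -!EFin_max -EFinD; congr EFin.
  case/orP: (le_total 0 (G a)) => G0.
    by rewrite ger0_norm// max_l// max_r ?addr0// oppr_le0.
  by rewrite ler0_norm// max_r// max_l ?add0r// oppr_ge0.
have : (0 <= \esum_(a in [set: A]) maxe (G a)%:E 0)%E by exact: esum_ge0.
have : (0 <= \esum_(a in [set: A]) maxe (- (G a)%:E) 0)%E by exact: esum_ge0.
case: (\esum_(a in [set: A]) maxe (- (G a)%:E) 0)%E => [y|_|//];
case: (\esum_(a in [set: A]) maxe (G a)%:E 0)%E => [z|_|//] //=.
all: rewrite ?normr0 ?leey// !lee_fin => y0 z0.
by rewrite (le_trans (ler_normB _ _))// !ger0_norm.
Qed.

Lemma transfer_ge0E (g : X * VV -> R) x v : regular mu C r x ->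
  (forall a, 0 <= g (scons a x, s a v)) ->
  (\esum_(a in [set: A])
     ((branch mu a x)%:E * (g (scons a x, s a v))%:E) < +oo)%E ->
  ((T g (x, v))%:E = \esum_(a in [set: A])
     ((branch mu a x)%:E * (g (scons a x, s a v))%:E))%E.
Proof.
move=> reg g0; have b0 a : 0 <= branch mu a x by case: (reg a 0%N) => /ltW.
rewrite transferE.
have bg a : 0 <= branch mu a x * g (scons a x, s a v) by rewrite mulr_ge0.
have -> : (\esum_(a in [set: A])
    maxe (branch mu a x * g (scons a x, s a v))%:E 0 = \esum_(a in [set: A])
     ((branch mu a x)%:E * (g (scons a x, s a v))%:E))%E.
  by apply: eq_esum => a _; rewrite max_l ?lee_fin// EFinM.
rewrite [X in (_ - X)%E]esum1; last first.
  by move=> a _; rewrite max_r// -EFinN lee_fin oppr_le0.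
have : (0 <= \esum_(a in [set: A])
     ((branch mu a x)%:E * (g (scons a x, s a v))%:E))%E.
  by apply: esum_ge0 => a _; rewrite mule_ge0 ?lee_fin.
by move=> S0 Soo; rewrite sube0 fineK// ge0_fin_numE.
Qed.

Local Notation K k := (expR (C / (1 - r) * r ^+ k)).

Lemma holder_step k : K k = expR (C * r ^+ k) * K k.+1.
Proof.
rewrite -expRD; congr expR; rewrite exprS.
by field; case/andP: r01 => r0 r1; rewrite subr_eq0 gt_eqF.
Qed.

Lemma holder_ge1 k : 1 <= K k.
Proof.
rewrite -[leLHS]expR0 ler_expR; case/andP: r01 => r0 r1.
apply: mulr_ge0; last by apply: exprn_ge0; exact: ltW.
by apply: divr_ge0; rewrite ?subr_ge0 ltW.
Qed.

Let q_gt0 u a : 0 < q u a.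
Proof. by apply: letter_weight_gt0; exact: (mass_gt0 mu_holder). Qed.

(** All prefix lengths [k] are treated at once, because the bound at [x] with [k] uses the bound at
    [ax] with [k.+1]. *)
Lemma iter_transfer_le (h : V -> R) (f : X * VV -> R) n :
  (forall v, 0 <= h v) ->
  (\forall x \ae mu, forall v : V, `|f (x, v)| <= h v) ->
  \forall x \ae mu, forall k v, (`|iter n T f (x, v)|%:E <=
     (K k)%:E * walk_from h n (mkseq x k) v)%E.
Proof.
move=> h0 fh; elim: n => [|n IH].
  apply: filterS fh => x fh k v /=; rewrite -EFinM lee_fin.
  apply: (le_trans (fh v)); rewrite ler_peMl//; exact: holder_ge1.
move: ae_regular (ae_scons mu_holder IH); apply: filterS2 => x reg xIH k v.
rewrite iterS; apply: le_trans (transfer_le _ _ reg) _.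
have walk0 u w : (0 <= walk_from h n u w)%E.
  by apply: (iter_walk_ge0 s q_gt0) => *; rewrite lee_fin.
rewrite [in leRHS]iterS {1}/walk -esumZl ?expR_ge0//; last first.
  by move=> a _; rewrite mule_ge0 ?lee_fin// ltW.
apply: le_esum => a _; have [b0 b1 _] := reg a k.
have := xIH a k.+1 (s a v); rewrite mkseq_scons => xa.
apply: (@le_trans _ _ ((expR (C * r ^+ k) * q (mkseq x k) a)%:E *
   ((K k.+1)%:E * walk_from h n (a :: mkseq x k) (s a v)))%E).
  by apply: lee_pmul => //; rewrite lee_fin// ltW.
by rewrite (holder_step k) (EFinM _ (q _ _)) (EFinM _ (K k.+1)) muleACA.
Qed.

Lemma iter_transfer_ge (h : V -> R) (B : R) n :
  (forall v, 0 <= h v <= B) ->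
  \forall x \ae mu, forall k v,
    0 <= iter n T (fun z : X * VV => h z.2) (x, v) /\
    (walk_from h n (mkseq x k) v <=
      (K k)%:E * (iter n T (fun z : X * VV => h z.2) (x, v))%:E)%E.
Proof.
move=> hB; have h0 v : 0 <= h v by case/andP: (hB v).
have B0 : 0 <= B by have /andP[b0 bB] := hB point; exact: le_trans b0 bB.
set f := fun z : X * VV => h z.2.
have fh : \forall x \ae mu, forall v : V, `|f (x, v)| <= h v.
  by apply: aeW => x v; rewrite ger0_norm// h0.
elim: n => [|n IH].
  apply: aeW => x k v /=; rewrite -EFinM lee_fin; split; first exact: h0.
  by rewrite ler_peMl// ?holder_ge1// h0.
have {}IH := ae_scons mu_holder IH.
move: IH (ae_scons mu_holder (iter_transfer_le n h0 fh)) ae_regular.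
apply: filterS3 => x IH up reg k v.
have g0 a : 0 <= iter n T f (scons a x, s a v) by case: (IH a 0%N (s a v)).
have walkB u w : (walk_from h n u w <= B%:E)%E.
  have q_sum := letter_weight_sum mu_inv (mass_gt0 mu_holder).
  apply: (iter_walk_le s q_gt0 q_sum) => //.
  by move=> _ v'; rewrite lee_fin; case/andP: (hB v').
(* Finiteness comes from the upper bound, and is needed because [fine] would turn an infinite sum
   into 0. *)
have fin_sum : (\esum_(a in [set: A])
     ((branch mu a x)%:E * (iter n T f (scons a x, s a v))%:E) < +oo)%E.
  apply: (@le_lt_trans _ _ ((K 0 * B)%:E *
    \esum_(a in [set: A]) (branch mu a x)%:E)%E).
    rewrite -esumZl; last 2 first.
    - by rewrite mulr_ge0 ?expR_ge0.
    - by move=> a _; rewrite lee_fin; case: (reg a 0%N) => /ltW.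
    apply: le_esum => a _; rewrite muleC.
    apply: lee_wpmul2r; first by rewrite lee_fin; case: (reg a 0%N) => /ltW.
    have := up a 0%N (s a v); rewrite ger0_norm ?g0// => /le_trans; apply.
    by rewrite EFinM lee_wpmul2l// lee_fin expR_ge0.
  by rewrite (branch_sum mu_inv mu_holder C_gt0 r01 reg) mule1 ltry.
rewrite iterS (transfer_ge0E reg g0 fin_sum); split.
  rewrite -lee_fin (transfer_ge0E reg g0 fin_sum); apply: esum_ge0 => a _.
  by rewrite mule_ge0 ?lee_fin//; case: (reg a 0%N) => /ltW.
rewrite {1}/walk -esumZl ?expR_ge0//; last first.
  by move=> a _; rewrite mule_ge0 ?lee_fin//; case: (reg a 0%N) => /ltW.
apply: le_esum => a _; have [b0 _ b1] := reg a k.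
have [_] := IH a k.+1 (s a v); rewrite mkseq_scons => xa.
apply: (@le_trans _ _ ((expR (C * r ^+ k) * branch mu a x)%:E *
   ((K k.+1)%:E * (iter n T f (scons a x, s a v))%:E))%E).
  apply: lee_pmul => //; first by rewrite lee_fin ltW.
  by apply: (iter_walk_ge0 s q_gt0) => *; rewrite lee_fin.
by rewrite (holder_step k) (EFinM _ (branch _ _ _)) (EFinM _ (K k.+1)) muleACA.
Qed.

End transfer_bounds.

(** * Norms and spectral radius *)

Section root_limits.
Context (R : realType).

Lemma expR_div_cvg1 (x : R) :
  (fun n : nat => (expR (x * n%:R^-1))%:E) @ \oo --> 1%:E.
Proof.
have -> : 1%:E = (expR (x * 0))%:E :> \bar R by rewrite mulr0 expR0.
apply: cvg_EFin; first exact: nearW.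
apply: (@continuous_cvg _ _ _ _ _ _ (@expR R)); first exact: continuous_expR.
apply: cvgMr; apply/cvgrPdist_lt => e e0.
have := @cvg_harmonic R; move/cvgrPdist_lt => /(_ _ e0) [n _ h].
by exists n.+1 => // -[//|m] nm; exact: (h m nm).
Qed.

Lemma root_limit_eq1 (u : nat -> \bar R) (c0 c1 : R) : 0 < c0 ->
  (forall n, c0%:E <= u n <= c1%:E)%E ->
  limn (fun n => poweR (u n) n%:R^-1) = 1%E.
Proof.
move=> c00 uc; apply/cvg_lim => //.
have c10 : 0 < c1.
  have /andP[h1 h2] := uc 0%N; have := le_trans h1 h2.
  by rewrite lee_fin; exact: lt_le_trans.
have u0 n : (0 <= u n)%E.
  by have /andP[h1 _] := uc n; apply: le_trans h1; rewrite lee_fin ltW.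
apply: (squeeze_cvge _ (expR_div_cvg1 (ln c0)) (expR_div_cvg1 (ln c1))).
apply: nearW => n; rewrite !expRM !lnK// -!poweR_EFin.
have n0 : 0 <= n%:R^-1 :> R by rewrite invr_ge0.
have /andP[h1 h2] := uc n.
by rewrite !gt0_ler_poweR// in_itv/= ?leey ?andbT// lee_fin ltW.
Qed.

Lemma root_limit_neq1 (u : nat -> \bar R) (N : nat) (c t : R) : (0 < N)%N ->
  0 < t -> (forall n, 0 <= u n)%E ->
  (forall j, u (N * j)%N <= (expR (c - t * j%:R))%:E)%E ->
  limn (fun n => poweR (u n) n%:R^-1) <> 1%E.
Proof.
move=> N0 t0 u0 uN lim1.
set v := fun n => _ in lim1.
(* The limit of a divergent sequence is the default value 0, which also differs from 1. *)
have [cv|ncv] := pselect (cvgn v); last first.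
  by move: lim1; rewrite dvgP//; apply/eqP; rewrite eq_sym onee_eq0.
rewrite lim1 in cv.
have cvN : (v \o muln N) @ \oo --> 1%E.
  by apply: cvg_comp cv; exact: cvg_mulnl.
have N0' : 0 < N%:R :> R by rewrite ltr0n.
have : (1 <= (expR (- t / (2 * N%:R)))%:E :> \bar R)%E.
  rewrite -(cvg_lim _ cvN)//; apply: lime_le; first by apply/cvg_ex; exists 1%E.
  (* From [j0] on, half of the exponential rate absorbs the constant [c]. *)
  have [j0 cj0] : exists j0, c <= t / 2 * j0%:R.
    exists (Num.bound `|c / (t / 2)|).
    rewrite -ler_pdivrMl ?divr_gt0// mulrC.
    by apply: le_trans (ler_norm _) _; apply: ltW; exact: archi_boundP (normr_ge0 _).
  exists j0.+1 => // j /= jj0.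
  have j_gt0 : 0 < j%:R :> R by rewrite ltr0n; exact: leq_trans jj0.
  apply: (@le_trans _ _ (poweR (expR (c - t * j%:R))%:E (N * j)%:R^-1)).
    apply: gt0_ler_poweR;
      by rewrite ?in_itv/= ?leey ?andbT ?invr_ge0 ?lee_fin ?expR_ge0.
  rewrite poweR_EFin -expRM lee_fin ler_expR natrM.
  rewrite ler_pdivrMr ?mulr_gt0//.
  have -> : - t / (2 * N%:R) * (N%:R * j%:R) = - t / 2 * j%:R.
    by field; rewrite gt_eqF.
  have : t / 2 * j0%:R <= t / 2 * j%:R.
    by rewrite ler_pM2l ?divr_gt0// ler_nat ltnW.
  lra.
rewrite lee_fin -[leLHS]expR0 ler_expR leNgt => /negP; apply.
by rewrite mulNr oppr_lt0 divr_gt0// mulr_gt0.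
Qed.

End root_limits.

Section hilbert_norm.
Context (R : realType) (A V : pcountType).
Local Notation X := (seq_space A).
Local Notation VV := (vertices V).
Variable mu : probability X R.
Implicit Type f : X * VV -> R.

Let mu_gt0 : (0 < mu [set: X])%E.
Proof. by rewrite probability_setT. Qed.

Lemma Lnorm_leP (f : X -> R) (y : \bar R) :
  (\forall x \ae mu, `|f x|%:E <= y)%E -> ('N[mu]_+oo[EFin \o f] <= y)%E.
Proof.
move=> fy; rewrite unlock mu_gt0; apply: ereal_inf_lbound.
exact: fy.
Qed.

Lemma Lnorm_geP (f : X -> R) (y : \bar R) :
  (\forall x \ae mu, y <= `|f x|%:E)%E -> (y <= 'N[mu]_+oo[EFin \o f])%E.
Proof.
move=> fy; rewrite unlock mu_gt0; apply: le_ereal_inf_tmp => z /= fz.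
have : ProperFilter (almost_everywhere mu).
  exact: ae_properfilter_algebraOfSetsType.
move=> FF; have [x [h1 h2]] := filter_ex (filterI fy fz).
exact: le_trans h1 h2.
Qed.

Lemma Lnorm_ae (f : X -> R) :
  (\forall x \ae mu, `|f x|%:E <= 'N[mu]_+oo[EFin \o f])%E.
Proof. by rewrite unlock mu_gt0; exact: ess_sup_ge. Qed.

Lemma Hnorm_le f (h : V -> \bar R) (y : \bar R) :
  (\forall x \ae mu, forall v : V, `|f (x, v)|%:E <= h v)%E -> (0 <= y)%E ->
  (\esum_(v in [set: V]) h v ^+ 2 <= y)%E -> (Hnorm mu f <= sqrte y)%E.
Proof.
move=> fh y0 hy; rewrite lee_sqrt//; apply: le_trans hy; apply: le_esum => v _.
have N0 : (0 <= 'N[mu]_+oo[EFin \o (fun x => f (x, v))])%E by exact: Lnorm_ge0.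
have Nh : ('N[mu]_+oo[EFin \o (fun x => f (x, v))] <= h v)%E.
  by apply: Lnorm_leP; apply: filterS fh => x; exact.
by rewrite !expe2; apply: lee_pmul.
Qed.

Lemma Hnorm_ge f (h : V -> \bar R) : (forall v, 0 <= h v)%E ->
  (\forall x \ae mu, forall v : V, h v <= `|f (x, v)|%:E)%E ->
  (sqrte (\esum_(v in [set: V]) h v ^+ 2) <= Hnorm mu f)%E.
Proof.
move=> h0 fh; rewrite lee_sqrt; last first.
  by apply: esum_ge0 => v _; rewrite expe2 mule_ge0// Lnorm_ge0.
apply: le_esum => v _; rewrite !expe2.
have hN : (h v <= 'N[mu]_+oo[EFin \o (fun x => f (x, v))])%E.
  by apply: Lnorm_geP; apply: filterS fh => x; exact.
by apply: lee_pmul.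
Qed.

(** The envelope is the essential supremum at each vertex; it reduces operator norms to functions of
    the vertex alone. *)
Lemma Hnorm_envelope f : (Hnorm mu f <= 1)%E -> exists h : V -> R,
  [/\ forall v, 0 <= h v, (\esum_(v in [set: V]) (h v ^+ 2)%:E <= 1)%E &
    \forall x \ae mu, forall v : V, `|f (x, v)| <= h v].
Proof.
set N := fun v : V => 'N[mu]_+oo[EFin \o (fun x => f (x, v))]%E.
have N0 v : (0 <= N v)%E by exact: Lnorm_ge0.
have -> : Hnorm mu f = sqrte (\esum_(v in [set: V]) N v ^+ 2)%E by [].
rewrite -[leRHS](_ : sqrte 1 = 1)%E; last by rewrite /= sqrtr1.
rewrite lee_sqrt// => N1.
have Nfin v : N v \is a fin_num.
  have : (N v ^+ 2 <= 1)%E.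
    by apply: le_trans N1; exact: (@esum_ge_term R V setT (fun v => N v ^+ 2)%E v).
  by case: (N v) (N0 v) => // _; rewrite expe2 mulyy leye_eq.
exists (fun v => fine (N v)); split.
- by move=> v; rewrite fine_ge0.
- by apply: le_trans N1; apply: le_esum => v _; rewrite EFin_expe fineK.
- apply: ae_countable => v; apply: filterS (Lnorm_ae (fun x => f (x, v))) => x.
  by rewrite -/(N v) -lee_fin fineK.
Qed.

End hilbert_norm.

Section spectral.
Context (R : realType) (A V : pcountType).
Local Notation X := (seq_space A).
Local Notation VV := (vertices V).
Variables (mu : probability X R) (kappa : X -> V -> V).
Hypothesis mu_inv : theta_invariant mu.
Hypothesis mu_holder : log_holder mu.
Variable s : A -> V -> V.
Hypothesis kappa_s : forall x v, kappa x (s (x 0%N) v) = v.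
Hypothesis s_kappa : forall x v, s (x 0%N) (kappa x v) = v.
Variables (C r : R).
Hypothesis C_gt0 : 0 < C.
Hypothesis r01 : 0 < r < 1.
Hypothesis ae_regular : \forall x \ae mu, regular mu C r x.
Local Notation q := (letter_weight mu).
Hypothesis q_holder : forall k u u' a, (k <= size u)%N -> (k <= size u')%N ->
  take k u = take k u' -> q u a <= expR (C * r ^+ k) * q u' a.

Local Notation T := (transfer mu kappa).
Local Notation walk := (walk q s).
Local Notation walk_from h n := (iter n walk (fun=> EFin \o h)).
Local Notation D := (expR (C / (1 - r))).

Let q_gt0 u a : 0 < q u a.
Proof. by apply: letter_weight_gt0; exact: (mass_gt0 mu_holder). Qed.

Let q_sum u : (\esum_(a in [set: A]) (q u a)%:E = 1)%E.
Proof. exact: (letter_weight_sum mu_inv (mass_gt0 mu_holder)). Qed.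

Let s_bij a : bijective (s a).
Proof.
exists (kappa (fun=> a)) => v; first exact: (kappa_s (fun=> a)).
exact: (s_kappa (fun=> a)).
Qed.

(** This is [iter_transfer_le] at [k = 0], where the prefix is the empty word and the distortion is
    [D]. *)
Lemma Hopnorm_le n (y : R) : 0 <= y ->
  (forall h : V -> R, (forall v, 0 <= h v) ->
    (\esum_(v in [set: V]) (h v ^+ 2)%:E <= 1)%E ->
    (\esum_(v in [set: V]) walk_from h n [::] v ^+ 2 <= y%:E)%E) ->
  (Hopnorm mu (iter n T) <= sqrte (D ^+ 2 * y)%:E)%E.
Proof.
move=> y0 hy; apply: ge_ereal_sup => _ [f [_ f1] <-].
have [h [h0 h1 fh]] := Hnorm_envelope f1.
have walk0 v : (0 <= walk_from h n [::] v)%E.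
  by apply: (iter_walk_ge0 s q_gt0) => *; rewrite lee_fin.
apply: (@Hnorm_le R A V mu _ (fun v => D%:E * walk_from h n [::] v)%E).
- have := iter_transfer_le mu_holder kappa_s s_kappa C_gt0 r01 ae_regular n h0 fh.
  by apply: filterS => x /(_ 0%N); rewrite expr0 mulr1.
- by rewrite lee_fin mulr_ge0 ?sqr_ge0.
rewrite EFinM; apply: le_trans (lee_wpmul2l _ (hy h h0 h1)); last first.
  by rewrite lee_fin sqr_ge0.
rewrite -esumZl ?sqr_ge0//; last by move=> v _; rewrite expe2 mule_ge0.
by apply: le_esum => v _; rewrite !expe2 expr2 EFinM muleACA.
Qed.

(** The test function is the indicator of [K] divided by the square root of its size, a point of the
    unit ball. *)
Lemma Hopnorm_ge n (K : {fset V}) : K != fset0 ->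
  ((#|` K|%:R / 2)%:E <= \esum_(v in [set: V])
    walk_from (fun v => (v \in K)%:R) n [::] v ^+ 2)%E ->
  (sqrte (D^-1 ^+ 2 / 2)%:E <= Hopnorm mu (iter n T))%E.
Proof.
move=> K0 hK.
have K_gt0 : 0 < #|` K|%:R :> R by rewrite ltr0n cardfs_gt0.
pose c : R := (Num.sqrt #|` K|%:R)^-1.
have c0 : 0 <= c by rewrite invr_ge0 sqrtr_ge0.
have c2 : c ^+ 2 = #|` K|%:R^-1 by rewrite exprVn sqr_sqrtr// ltW.
pose ind (v : V) : R := (v \in K)%:R.
have ind01 v : 0 <= ind v <= 1 by rewrite /ind; case: (v \in K); rewrite ?lexx ler01.
have ind0 v : 0 <= ind v by case/andP: (ind01 v).
pose h v := c * ind v.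
have hB v : 0 <= h v <= c.
  by rewrite /h mulr_ge0//= ler_piMr//; case/andP: (ind01 v).
have h0 v : 0 <= h v by case/andP: (hB v).
have walkE v : (walk_from h n [::] v = c%:E * walk_from ind n [::] v)%E.
  have -> : (fun=> EFin \o h) =
      (fun (_ : seq A) (v : V) => c%:E * (EFin \o ind) v)%E.
    by apply/funext => u; apply/funext => w; rewrite /h /= EFinM.
  by rewrite (@iter_walkZ R A V q s q_gt0 n c (fun=> EFin \o ind))// => *;
    rewrite lee_fin.
have walk0 v : (0 <= walk_from ind n [::] v)%E.
  by apply: (iter_walk_ge0 s q_gt0) => *; rewrite lee_fin.
pose f (z : X * VV) := h z.2.
have f1 : Hinf mu f /\ (Hnorm mu f <= 1)%E.
  have N1 : (Hnorm mu f <= 1)%E.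
    rewrite -[leRHS](_ : sqrte 1 = 1)%E; last by rewrite /= sqrtr1.
    apply: (@Hnorm_le R A V mu _ (EFin \o h)) => //.
      by apply: aeW => x v; rewrite /f /= ger0_norm ?h0.
    apply: ge_esum_fset => K' _.
    rewrite (eq_bigr (fun v => (h v ^+ 2)%:E)); last first.
      by move=> v _; rewrite EFin_expe.
    rewrite sumEFin lee_fin.
    under eq_bigr do rewrite exprMn c2.
    rewrite -mulr_sumr mulrC ler_pdivrMr// mul1r.
    rewrite card_fset_sum1 natr_sum.
    rewrite (big_fsetID _ (mem K))/= [X in _ + X]big1_seq ?addr0; last first.
      by move=> v; rewrite !inE/= /ind => /andP[_ /negPf ->]; rewrite expr0n.
    apply: (@le_trans _ _ (\sum_(v <- [fset x | x in K' & x \in K]%fset) 1)).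
      apply: ler_sum => v _; rewrite expr_le1//; by case/andP: (ind01 v).
    have -> : \sum_(v <- [fset x | x in K' & x \in K]%fset) 1 =
        #|` [fset x | x in K' & x \in K]%fset|%:R :> R.
      by rewrite card_fset_sum1 natr_sum.
    rewrite -natr_sum -card_fset_sum1 ler_nat; apply: fsubset_leq_card.
    by apply/fsubsetP => v; rewrite !inE/= => /andP[].
  split => //; split; last by apply: le_lt_trans N1 _; rewrite ltry.
  have mh : measurable_fun [set: VV] h by move=> _ B mB.
  exact: (measurableT_comp mh (@measurable_snd _ _ X VV)).
apply: le_trans (ereal_sup_ubound _); last by exists f.
have := iter_transfer_ge mu_inv mu_holder kappa_s s_kappa C_gt0 r01 ae_regular n hB.
move=> low.
apply: le_trans (@Hnorm_ge R A V mu _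
  (fun v => (D^-1)%:E * walk_from h n [::] v)%E _ _); last 2 first.
- move=> v; rewrite walkE mule_ge0 ?mule_ge0 ?lee_fin// invr_ge0 expR_ge0//.
- apply: filterS low => x /(_ 0%N) + v => /(_ v); rewrite expr0 mulr1 => -[T0 TD].
  apply: le_trans (lee_wpmul2l _ TD) _; first by rewrite lee_fin invr_ge0 expR_ge0.
  have Dn0 : D != 0 by rewrite gt_eqF ?expR_gt0.
  by rewrite -!EFinM mulrA mulVf// mul1r lee_fin ler_norm.
rewrite lee_sqrt; last first.
  apply: esum_ge0 => v _.
  by rewrite expe2 walkE !mule_ge0// lee_fin ?invr_ge0 ?expR_ge0.
have -> : (fun v => ((D^-1)%:E * walk_from h n [::] v) ^+ 2)%E =
    (fun v => (D^-1 ^+ 2 * c ^+ 2)%:E * walk_from ind n [::] v ^+ 2)%E.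
  apply/funext => v; rewrite walkE !expe2 !expr2 !EFinM.
  by rewrite muleACA [X in (_ * X)%E = _]muleACA !muleA.
rewrite esumZl; last 2 first.
- by rewrite mulr_ge0 ?sqr_ge0.
- by move=> v _; rewrite expe2 mule_ge0.
apply: le_trans (lee_wpmul2l _ hK); last by rewrite lee_fin mulr_ge0 ?sqr_ge0.
rewrite -EFinM lee_fin c2 -[leRHS]mulrA ler_wpM2l ?sqr_ge0//.
by rewrite mulrA mulVf ?mul1r// gt_eqF.
Qed.

Definition folner := forall eps : R, 0 < eps -> exists2 K : {fset V},
  K != fset0 & (walk_boundary q s K <= (eps * #|` K|%:R)%:E)%E.

Lemma spectral_radius_folner (J : {fset A}) :
  (forall v, exists2 a, a \in J & s a v = v) ->
  spectral_radius mu T = 1%E <-> folner.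
Proof.
move=> loops; split.
  move=> rad1; apply: contrapT => nfol.
  have [eps eps0 bd] : exists2 eps : R, 0 < eps &
      forall K : {fset V}, K != fset0 ->
      ((eps * #|` K|%:R)%:E < walk_boundary q s K)%E.
    apply: contrapT => no; apply: nfol => eps eps0; apply: contrapT => noK.
    apply: no; exists eps => // K K0; rewrite ltNge; apply/negP => bd.
    by apply: noK; exists K.
  have [N N0 [d /andP[d0 d1] dec]] :=
    decay q_gt0 q_sum C_gt0 r01 q_holder s_bij eps0 bd loops.
  have d10 : 0 < 1 - d by rewrite subr_gt0.
  (* The decay concerns squared norms, so the rate is halved. *)
  apply: (@root_limit_neq1 R (fun n => Hopnorm mu (iter n T)) N (ln D)
    (- ln (1 - d) / 2) N0) rad1.
  - by rewrite divr_gt0// oppr_gt0 ln_lt0// d10/= gtrBl.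
  (* The zero function shows that the supremum defining the operator norm is nonnegative. *)
  - move=> n; pose z : X * VV -> R := fun=> 0.
    apply: (@le_trans _ _ (Hnorm mu (iter n T z))).
      exact: sqrte_ge0.
    apply: ereal_sup_ubound; exists z => //.
    have H0 : Hnorm mu z = 0%E.
      apply/eqP; rewrite eq_le sqrte_ge0 andbT -[leRHS]sqrte0.
      apply: (@Hnorm_le R A V mu _ (fun=> 0%E)) => //.
        by apply: aeW => x v; rewrite normr0.
      by rewrite esum1// => v _; rewrite expe2 mule0.
    rewrite /= H0; split; last exact: lee01.
    by split; [exact: measurable_cst|rewrite H0 ltry].
  - move=> j; apply: le_trans (Hopnorm_le (y := (1 - d) ^+ j) _ _) _.
    + by rewrite exprn_ge0// ltW.
    + by move=> h h0 h1; rewrite -[X in (X)%:E]mulr1; exact: dec.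
    have -> : D ^+ 2 * (1 - d) ^+ j = expR (ln D - (- ln (1 - d) / 2) * j%:R) ^+ 2.
      rewrite -expRM_natl -[X in _ * X ^+ j = _](@lnK _ (1 - d)) ?posrE//.
      rewrite -expRM_natl -expRM_natl -expRD expRK; congr expR.
      set y := C / (1 - r). by field.
    by rewrite /= sqrtr_sqr ger0_norm ?expR_ge0.
move=> fol.
have half : 0 < D^-1 ^+ 2 / 2 by rewrite divr_gt0// exprn_gt0// invr_gt0 expR_gt0.
apply: (@root_limit_eq1 R (fun n => Hopnorm mu (iter n T))
  (Num.sqrt (D^-1 ^+ 2 / 2)) (Num.sqrt (D ^+ 2 * 1))); first by rewrite sqrtr_gt0.
move=> n; apply/andP; split; last first.
  apply: (Hopnorm_le (y := 1)) => // h h0 h1.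
  exact: (esum_walk_from_sqr q_gt0 q_sum q_holder s_bij).
(* The Foelner set may depend on [n], since the resulting lower bound does not; [n.+1] keeps the
   constant meaningful at [n = 0]. *)
have e0 : 0 < (4 * (n.+1%:R * expR C))^-1 :> R.
  by rewrite invr_gt0 !mulr_gt0// ?ltr0n// expR_gt0.
have [K K0 Ke] := fol _ e0.
apply: (Hopnorm_ge K0).
apply: (nondecay q_gt0 q_sum q_holder s_bij [::] Ke).
have E0 := expR_gt0 C.
rewrite ler_pdivrMr; last by rewrite !mulr_gt0// ltr0n.
by rewrite -[n.+1%:R]natr1; lra.
Qed.

End spectral.

(** * Amenability *)

Section boundary.
Context (R : realType) (V : choiceType).

Lemma esum_in_fset (K : {fset V}) (x : V -> R) : (forall v, 0 <= x v) ->
  (\esum_(v in [set: V]) ((v \in K)%:R * x v)%:E = (\sum_(v <- K) x v)%:E)%E.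
Proof.
move=> x0.
transitivity (\esum_(v in [set` K]) (x v)%:E)%E.
  rewrite [RHS]esum_mkcond; apply: eq_esum => v _; rewrite mem_setE.
  by case: (v \in K); rewrite ?mul1r ?mul0r.
rewrite esum_fset//; last by move=> v _; rewrite lee_fin.
by rewrite fsbig_finite// set_fsetK sumEFin.
Qed.

(** Equivalently, as many points of [K] stay in it under [f] as under its inverse: [f] maps the
    former bijectively onto the latter. *)
Lemma sum_bij_out (K : {fset V}) (f g : V -> V) : cancel f g -> cancel g f ->
  \sum_(v <- K) ((f v \notin K)%:R : R) = \sum_(v <- K) (g v \notin K)%:R.
Proof.
move=> fK gK.
have outE (h : V -> V) : \sum_(v <- K) ((h v \notin K)%:R : R) =
    \sum_(v <- K) 1 - \sum_(v <- K) (h v \in K)%:R.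
  rewrite -sumrB; apply: eq_bigr => v _.
  by case: (h v \in K); rewrite ?subrr ?subr0.
rewrite !outE; congr (_ - _); apply: EFin_inj.
rewrite -!esum_in_fset; [|by move=> v; rewrite ler0n..].
have g_bij : bijective g by exists f.
rewrite -(esum_bij (fun v => ((v \in K)%:R * (f v \in K)%:R)%:E) g_bij).
by apply: eq_esum => v _; rewrite gK mulrC.
Qed.

(** The graph has its edges along [kappa], while the transfer operator follows the inverse maps; the
    weighted boundary does not see the difference. *)
Lemma walk_boundary_inv (A : choiceType) (q : seq A -> A -> R)
    (f g : A -> V -> V) (K : {fset V}) : (forall u a, 0 < q u a) ->
  (forall a, cancel (f a) (g a)) -> (forall a, cancel (g a) (f a)) ->
  walk_boundary q f K = walk_boundary q g K.
Proof.
move=> q0 fK gK; rewrite /walk_boundary -!esum_sum.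
- apply: eq_esum => a _; rewrite !sumEFin -!mulr_sumr.
  by rewrite (sum_bij_out K (fK a) (gK a)).
- by move=> a v _ _; rewrite lee_fin mulr_ge0// ltW.
- by move=> a v _ _; rewrite lee_fin mulr_ge0// ltW.
Qed.

End boundary.

Section amenability.
Context (R : realType) (A V : pcountType).
Local Notation X := (seq_space A).
Variables (mu : probability X R) (kappa : X -> V -> V) (E : set (V * V)).
Hypothesis mu_inv : theta_invariant mu.
Hypothesis mass_gt0 : forall w, 0 < mass mu w.
Hypothesis kappa_fst : forall x y : X, x 0%N = y 0%N -> kappa x = kappa y.
Hypothesis kappa_edge : forall x v, E (v, kappa x v).

Local Notation q := (letter_weight mu).
Local Notation kap := (fun a : A => kappa (fun=> a)).

Let q_gt0 u a : 0 < q u a. Proof. exact: letter_weight_gt0. Qed.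

Let q_sum u : (\esum_(a in [set: A]) (q u a)%:E = 1)%E.
Proof. exact: letter_weight_sum. Qed.

Lemma edge_prob_le (K : {fset V}) v w : w \notin K ->
  (edge_prob mu kappa (v, w) <=
   \esum_(a in [set: A]) (q [::] a * (kap a v \notin K)%:R)%:E)%E.
Proof.
move=> wK; rewrite /edge_prob.
have -> : [set x : X | kappa x v = w] = [set x : X | kap (x 0%N) v = w].
  apply/seteqP; split => x /=; by rewrite (@kappa_fst x (fun=> x 0%N)).
rewrite (mu_coord0 mu (fun a => kap a v = w)); apply: le_esum => a _.
rewrite lee_fin ler_wpM2l//; first exact: ltW.
by case: asboolP => [->|_]; rewrite ?wK.
Qed.

Lemma edge_prob_ge a v : ((q [::] a)%:E <= edge_prob mu kappa (v, kap a v))%E.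
Proof.
rewrite /edge_prob letter_weight_nil massE.
have -> : [set x : X | kappa x v = kap a v] =
    [set x : X | kap (x 0%N) v = kap a v].
  apply/seteqP; split => x /=; by rewrite (@kappa_fst x (fun=> x 0%N)).
apply: le_measure; rewrite ?inE; first exact: measurable_cylinder.
  exact: (measurable_coord0 (fun b => kap b v = kap a v)).
by move=> x [<-].
Qed.

(** If [e] is below the weight of every letter of [F], a vertex outside the [e]-boundary leaves [K]
    only by letters outside [F], of small total mass. Conversely, each vertex of the [e]-boundary
    contributes at least [e] to the weighted boundary, so a Foelner set has a small [e]-boundary. *)
Lemma amenable_folner : mu_amenable mu kappa E <-> folner mu kap.
Proof.
have x01 (b : bool) : 0 <= (b%:R : R) <= 1 by case: b; rewrite ?lexx ler01.
split=> [am eps eps0|fol].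
  have e2 : 0 < eps / 2 by rewrite divr_gt0.
  have [F Fe] := exists_fset_mass q_sum e2.
  have [k k0 kF] := @exists_lower_bound R A F (q [::]) (q_gt0 [::]).
  have near1 : \forall e \near (0 : R)^'+, (ereal_inf
    [set ((#|` eps_boundary mu kappa E e K|%:R / #|` K|%:R : R)%:E)
      | K in [set K : {fset V} | K != fset0]] < (eps / 2)%:E)%E.
    apply: (am [set y : \bar R | (y < (eps / 2)%:E)%E]).
    by apply: open_nbhs_nbhs; split; [exact: open_ereal_lt_ereal|rewrite /= lte_fin].
  have [e [inf_e ek]] := @filter_ex _ (0^'+ : set_system R) _ _
    (filterI near1 (nbhs_right_lt k0)).
  have [_ [K K0 <-]] := ereal_inf_lt inf_e.
  have K_gt0 : 0 < #|` K|%:R :> R by rewrite ltr0n cardfs_gt0.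
  rewrite lte_fin ltr_pdivrMr// => bdK.
  exists K => //; rewrite /walk_boundary.
  apply: (@le_trans _ _ (\sum_(v <- K)
      ((v \in eps_boundary mu kappa E e K)%:R + eps / 2)%:E)%E).
    rewrite big_seq [leRHS]big_seq; apply: lee_sum => v vK.
    apply: (le_trans (esum_tail q_gt0 q_sum Fe (fun a => x01 _))).
    rewrite lee_fin lerD2r.
    have [vb|vb] := boolP (v \in eps_boundary mu kappa E e K).
      change (\sum_(a <- F) q [::] a * (kap a v \notin K)%:R <= 1).
      rewrite -lee_fin -(q_sum [::]).
      apply: le_trans (@le_esum_fset R A setT (fun a => (q [::] a)%:E) F _) => //.
      rewrite -sumEFin; apply: lee_sum => a _.
      rewrite lee_fin ler_piMr//; first exact: ltW.
      by case/andP: (x01 (kap a v \notin K)).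
    rewrite big_seq big1// => a aF.
    have [|avK] := boolP (kap a v \in K); first by rewrite mulr0.
    case/negP: vb; rewrite !inE /= vK; apply/asboolP.
    exists (v, kap a v); split => //.
    apply: lt_le_trans (edge_prob_ge a v); rewrite lte_fin.
    exact: lt_le_trans (kF a aF).
  rewrite sumEFin lee_fin big_split/=.
  have -> : \sum_(v <- K) eps / 2 = eps / 2 * #|` K|%:R.
    rewrite card_fset_sum1 natr_sum mulr_sumr.
    by apply: eq_bigr => v _; rewrite mulr1.
  have -> : \sum_(v <- K) ((v \in eps_boundary mu kappa E e K)%:R : R) =
      #|` eps_boundary mu kappa E e K|%:R.
    have bK : (eps_boundary mu kappa E e K `<=` K)%fset.
      by apply/fsubsetP => v; rewrite !inE /= => /andP[].
    apply: EFin_inj.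
    have := @esum_in_fset R V K (fun v => (v \in eps_boundary mu kappa E e K)%:R)
      (fun v => ler0n _ _).
    move=> <-; rewrite card_fset_sum1 natr_sum.
    rewrite -(@esum_in_fset R V _ (fun=> 1)) => [|v]; last exact: ler01.
    apply: eq_esum => v _; rewrite mulr1.
    have [vb|vb] := boolP (v \in eps_boundary mu kappa E e K).
      by rewrite (fsubsetP bK _ vb) mul1r.
    by rewrite mulr0.
  by move: bdK; lra.
(* Under the Foelner condition the infimum is 0 for every positive [e], not just in the limit. *)
apply: cvg_near_cst.
near=> e.
have e0 : 0 < e by near: e; exact: nbhs_right_gt.
apply/eqP; rewrite eq_le; apply/andP; split; last first.
  apply: le_ereal_inf_tmp => _ [K _ <-]; rewrite lee_fin divr_ge0//.
apply/lee_addgt0Pr => d d0; rewrite add0e.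
have [K K0 KB] := fol (e * d) (mulr_gt0 e0 d0).
apply: ereal_inf_le.
exists (#|` eps_boundary mu kappa E e K|%:R / #|` K|%:R)%:E; first by exists K.
have K_gt0 : 0 < #|` K|%:R :> R by rewrite ltr0n cardfs_gt0.
rewrite lee_fin ler_pdivrMr// -(ler_pM2l e0) mulrA -lee_fin.
apply: le_trans KB; rewrite /walk_boundary.
have bK : (eps_boundary mu kappa E e K `<=` K)%fset.
  by apply/fsubsetP => v; rewrite !inE /= => /andP[].
rewrite [leRHS](big_fsetID _ (mem (eps_boundary mu kappa E e K)))/=.
have -> : [fset x | x in K & x \in eps_boundary mu kappa E e K]%fset =
    eps_boundary mu kappa E e K.
  move: bK; move: (eps_boundary mu kappa E e K) => B BK.
  apply/fsetP => v; rewrite !inE /=; apply/andP/idP => [[]//|vb].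
  by split => //; exact: (fsubsetP BK).
apply: (@le_trans _ _ (\sum_(v <- eps_boundary mu kappa E e K)
   \esum_(a in [set: A]) (q [::] a * (kap a v \notin K)%:R)%:E)%E); last first.
  apply: leeDl; apply: sume_ge0 => v _; apply: esum_ge0 => a _.
  by rewrite lee_fin mulr_ge0// ltW.
rewrite card_fset_sum1 natr_sum mulr_sumr -sumEFin.
rewrite big_seq [leRHS]big_seq; apply: lee_sum => v.
rewrite !inE /= => /andP[_ /asboolP [[v' w] /= [_ -> wK ew]]].
rewrite mulr1; apply: le_trans (edge_prob_le v wK); exact: ltW.
Unshelve. all: by end_near.
Qed.

End amenability.

(** * The almost invariance condition *)

Section vertex_integral.
Context (R : realType) (A V : pcountType).
Local Notation X := (seq_space A).
Local Notation VV := (vertices V).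
Variable mu : probability X R.
Local Notation m := (mu \x mV R V)%E.

Lemma mV_set1 (v : V) : mV R V [set (v : VV)] = 1%E.
Proof.
by rewrite /mV /counting asboolT ?fset_set1 ?cardfs1//; exact: finite_set1.
Qed.

Lemma mV_fset (K : {fset V}) : mV R V [set` K] = #|` K|%:R%:E.
Proof.
by rewrite /mV /counting asboolT ?set_fsetK//; exact: finite_fset.
Qed.

Lemma measurable_sections d (U : measurableType d) (f : X * VV -> U) :
  (forall v, measurable_fun [set: X] (fun x => f (x, v))) ->
  measurable_fun [set: X * VV] f.
Proof.
move=> mf _ B mB; rewrite setTI.
have -> : f @^-1` B =
    \bigcup_(v : V) ((fun x => f (x, v)) @^-1` B `*` [set (v : VV)]).
  apply/seteqP; split => [[x v] Bf|[x v] [w _ [/= Bf ->]]] //.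
  by exists v.
apply: countable_bigcup_measurable => v; apply: measurableX => //.
by rewrite -[X in measurable X]setTI; exact: mf.
Qed.

Lemma ae_sections (P : X * VV -> Prop) :
  (\forall x \ae mu, forall v, P (x, v)) -> \forall z \ae m, P z.
Proof.
move=> [N [mN N0 PN]]; exists (N `*` [set: VV]); split.
- exact: measurableX.
- transitivity (mu N * mV R V setT)%E; first exact: product_measure1E.
  by move: N0 => /= ->; rewrite mul0e.
- by move=> [x v] /= nP; split => //; apply: PN => /= h; exact: nP.
Qed.

(** The integrand is a countable combination of indicators of the strips over single vertices, each
    of measure 1. *)
Lemma integral_vertices (H : V -> R) : (forall v, 0 <= H v) ->
  (\int[m]_z (H z.2)%:E = \esum_(v in [set: V]) (H v)%:E)%E.
Proof.
move=> H0.
pose strip v : set (X * VV) := [set: X] `*` [set (v : VV)].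
have mstrip v : measurable (strip v) by exact: measurableX.
pose g v (z : X * VV) : \bar R := ((H v)%:E * (\1_(strip v) z)%:E)%E.
have g0 v z : (0 <= g v z)%E by rewrite mule_ge0 ?lee_fin// indicE.
have mg v : measurable_fun [set: X * VV] (g v).
  apply: measurable_funeM; apply/measurable_EFinP; exact: measurable_indic.
have HE z : (H z.2)%:E = (\esum_(v in [set: V]) g v z)%E.
  have := @esum_in_fset R V [fset z.2]%fset H H0; rewrite big_seq_fset1 => <-.
  apply: eq_esum => v _; rewrite /g -EFinM mulrC indicE.
  suff -> : (z \in strip v) = (v \in [fset z.2]%fset) by [].
  apply/idP/fset1P => [/set_mem[_ /=]|->]; first by move=> ->.
  by apply: mem_set.
under eq_integral do rewrite HE esum_pickle//.
rewrite integral_nneseries//; last 2 first.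
- move=> n; case: (choice.pickle_inv n : option V) => [v|] /=; first exact: mg.
  exact: measurable_cst.
- by move=> n z _; case: (choice.pickle_inv n : option V) => [v|] /=.
rewrite esum_pickle => [|v]; last by rewrite lee_fin.
apply: eq_eseriesr => n _.
case: (choice.pickle_inv n : option V) => [v|] /=; last by rewrite integral0.
have -> : (\int[m]_z g v z = (H v)%:E * \int[m]_z (\1_(strip v) z)%:E)%E.
  apply: ge0_integralZl => //.
    by apply/measurable_EFinP; exact: measurable_indic.
  by rewrite lee_fin.
rewrite integral_indic// setIT.
transitivity ((H v)%:E * (mu [set: X] * mV R V [set (v : VV)]))%E.
  congr (_ * _)%E; exact: product_measure1E.
by rewrite probability_setT mV_set1 !mule1.
Qed.

End vertex_integral.

Section almost_invariant.
Context (R : realType) (A V : pcountType).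
Local Notation X := (seq_space A).
Local Notation VV := (vertices V).
Variables (mu : probability X R) (kappa : X -> V -> V).
Hypothesis mu_inv : theta_invariant mu.
Hypothesis mu_holder : log_holder mu.
Variable s : A -> V -> V.
Hypothesis kappa_s : forall x v, kappa x (s (x 0%N) v) = v.
Hypothesis s_kappa : forall x v, s (x 0%N) (kappa x v) = v.
Variables (C r : R).
Hypothesis C_gt0 : 0 < C.
Hypothesis r01 : 0 < r < 1.
Hypothesis ae_regular : \forall x \ae mu, regular mu C r x.

Local Notation q := (letter_weight mu).
Local Notation T := (transfer mu kappa).
Local Notation m := (mu \x mV R V)%E.
Local Notation kap := (fun a : A => kappa (fun=> a)).
Implicit Types (K : {fset V}) (v : V).
Local Notation box K := ([set: X] `*` [set` K]).
Local Notation deviation K := (fun z : X * VV =>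
  `| T \1_(box K) z - \1_(box K) z |).

Let q_gt0 u a : 0 < q u a.
Proof. by apply: letter_weight_gt0; exact: (mass_gt0 mu_holder). Qed.

Let q_ge0 u a : 0 <= q u a. Proof. exact: ltW. Qed.

Let q_sum u : (\esum_(a in [set: A]) (q u a)%:E = 1)%E.
Proof. exact: (letter_weight_sum mu_inv (mass_gt0 mu_holder)). Qed.

Let bool01 (b : bool) : 0 <= (b%:R : R) <= 1.
Proof. by case: b; rewrite ?lexx ler01. Qed.

(** The flag selects the letters that move [v] into [K] (true) or out of it (false). *)
Definition escape (K : {fset V}) (b : bool) (v : V) : R :=
  fine (\esum_(a in [set: A]) (q [::] a * ((s a v \in K) == b)%:R)%:E)%E.

Lemma escapeE K b v : (\esum_(a in [set: A])
  (q [::] a * ((s a v \in K) == b)%:R)%:E = (escape K b v)%:E)%E.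
Proof.
rewrite /escape fineK// ge0_fin_numE; last first.
  by apply: esum_ge0 => a _; rewrite lee_fin mulr_ge0.
apply: (@le_lt_trans _ _ 1%E); last by rewrite ltry.
rewrite -(q_sum [::]); apply: le_esum => a _.
by rewrite lee_fin ler_piMr//; case/andP: (bool01 ((s a v \in K) == b)).
Qed.

Lemma escape_ge0 K b v : 0 <= escape K b v.
Proof.
rewrite -lee_fin -escapeE; apply: esum_ge0 => a _.
by rewrite lee_fin mulr_ge0.
Qed.

Lemma indic_box K x v : \1_(box K) (x, v) = (v \in K)%:R :> R.
Proof.
rewrite indicE; suff -> : ((x, v) \in box K) = (v \in K) by [].
apply/idP/idP => [/set_mem[_ //]|vK]; exact: mem_set.
Qed.

(** For [v] in [K] the deviation is [1 - T 1_K], which by [branch_sum] is the total branch weight of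
    the letters leaving [K]; for [v] outside it is that of the letters entering. Hence the flag
    [v \notin K]. *)
Lemma deviation_bounds K x v : regular mu C r x ->
  deviation K (x, v) <= expR C * escape K (v \notin K) v /\
  escape K (v \notin K) v <= expR C * deviation K (x, v).
Proof.
move=> reg.
have b0 a : 0 <= branch mu a x by case: (reg a 0%N) => /ltW.
have bsum := branch_sum mu_inv mu_holder C_gt0 r01 reg.
have bfin b : exists2 y : R, 0 <= y & (\esum_(a in [set: A])
    ((branch mu a x)%:E * ((s a v \in K) == b)%:R%:E) = y%:E)%E.
  have : (\esum_(a in [set: A])
      ((branch mu a x)%:E * ((s a v \in K) == b)%:R%:E) <= 1)%E.
    rewrite -bsum; apply: le_esum => a _; rewrite -EFinM lee_fin ler_piMr//.
    by case/andP: (bool01 ((s a v \in K) == b)).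
  have : (0 <= \esum_(a in [set: A])
      ((branch mu a x)%:E * ((s a v \in K) == b)%:R%:E))%E.
    by apply: esum_ge0 => a _; rewrite -EFinM lee_fin mulr_ge0.
  case: (\esum_(a in _) _)%E => [y|//|//]; rewrite lee_fin => y0 _.
  by exists y.
have bnd b y : (\esum_(a in [set: A])
    ((branch mu a x)%:E * ((s a v \in K) == b)%:R%:E) = y%:E)%E ->
    y <= expR C * escape K b v /\ escape K b v <= expR C * y.
  have eC a : branch mu a x <= expR C * q [::] a /\
      q [::] a <= expR C * branch mu a x.
    by have [_] := reg a 0%N; rewrite expr0 mulr1.
  move=> yE; rewrite -!lee_fin [in X in _ /\ X]EFinM EFinM -yE -escapeE.
  rewrite -!esumZl ?expR_ge0//; last 2 first.
  - by move=> a _; rewrite -EFinM lee_fin mulr_ge0.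
  - by move=> a _; rewrite lee_fin mulr_ge0.
  split; apply: le_esum => a _; rewrite -!EFinM lee_fin mulrA ler_wpM2r//.
  - by case: (eC a).
  - by case: (eC a).
have [y y0 yE] := bfin true; have [y' y'0 y'E] := bfin false.
have yy' : y + y' = 1.
  apply: EFin_inj; rewrite EFinD -yE -y'E -esumD.
  - rewrite -[RHS]bsum; apply: eq_esum => a _; rewrite -!EFinM -EFinD -mulrDr.
    by case: (s a v \in K); rewrite ?addr0 ?add0r mulr1.
  - by move=> a _; rewrite -EFinM lee_fin mulr_ge0.
  - by move=> a _; rewrite -EFinM lee_fin mulr_ge0.
have TE : T \1_(box K) (x, v) = y.
  apply: EFin_inj; rewrite -yE (transfer_ge0E kappa_s s_kappa reg).
  - by apply: eq_esum => a _; rewrite indic_box eqb_id.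
  - by move=> a; rewrite indic_box.
  - rewrite (_ : (\esum_(a in _) _)%E = y%:E) ?ltry// -yE.
    by apply: eq_esum => a _; rewrite indic_box eqb_id.
rewrite TE indic_box; have [vK|vK] := boolP (v \in K) => /=.
  have -> : `|y - 1| = y' by rewrite -yy' opprD addNKr normrN ger0_norm.
  exact: bnd.
by rewrite subr0 ger0_norm//; exact: bnd.
Qed.

Lemma measurable_deviation K : measurable_fun [set: X * VV] (deviation K).
Proof.
apply: measurable_sections => v.
apply: measurableT_comp => //.
have mb a : measurable_fun [set: X] (branch mu a).
  exact: measurableT_comp (fine_measurable _) (measurable_phi mu_holder _).
have mT (g : A -> X -> \bar R) : (forall a x, 0 <= g a x)%E ->
    (forall a, measurable_fun [set: X] (g a)) ->
    measurable_fun [set: X] (fun x => \esum_(a in [set: A]) g a x)%E.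
  move=> g0 mg.
  rewrite (_ : (fun x => _) = fun x => (\sum_(n <oo)
      oapp (g ^~ x) 0 (choice.pickle_inv n : option A))%E); last first.
    by apply/funext => x; rewrite esum_pickle.
  apply: (ge0_emeasurable_sum (P := xpredT)) => [n x _ _|n _].
    by case: (choice.pickle_inv n : option A) => [a|] /=.
  by case: (choice.pickle_inv n : option A) => [a|] /=.
apply: measurable_funB; last first.
  rewrite (_ : (fun x => _) = cst (v \in K)%:R) //.
  by apply/funext => x; rewrite indic_box.
rewrite (_ : (fun x => _) = fun x => T \1_(box K) (x, v)) //.
under [X in measurable_fun _ X]eq_fun do rewrite (transferE mu kappa_s s_kappa).
apply: measurableT_comp; first exact: fine_measurable.
apply: emeasurable_funB; apply: mT => [a x|a].
- by rewrite le_max lexx orbT.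
- apply: measurable_maxe => //; apply/measurable_EFinP.
  apply: measurable_funM => //.
  rewrite (_ : (fun x => _) = cst (s a v \in K)%:R) //.
  by apply/funext => x; rewrite indic_box.
- by rewrite le_max lexx orbT.
- apply: measurable_maxe => //; apply: measurableT_comp => //.
  apply/measurable_EFinP; apply: measurable_funM => //.
  rewrite (_ : (fun x => _) = cst (s a v \in K)%:R) //.
  by apply/funext => x; rewrite indic_box.
Qed.

Lemma esum_escape_in K : (\esum_(v in [set: V])
  ((v \in K)%:R * escape K false v)%:E = walk_boundary q s K)%E.
Proof.
rewrite esum_in_fset; last by move=> v; exact: escape_ge0.
rewrite -sumEFin /walk_boundary; apply: eq_bigr => v _; rewrite -escapeE.
by apply: eq_esum => a _; case: (s a v \in K).
Qed.

(** For each letter, the points entering [K] under [s a] are the images of the points leaving [K]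
    under its inverse; [walk_boundary_inv] then returns to [s]. *)
Lemma esum_escape_out K : (\esum_(v in [set: V])
  ((v \notin K)%:R * escape K true v)%:E = walk_boundary q s K)%E.
Proof.
have kap_s a : cancel (s a) (kap a) by move=> v; exact: (kappa_s (fun=> a)).
have s_kap a : cancel (kap a) (s a) by move=> v; exact: (s_kappa (fun=> a)).
rewrite (walk_boundary_inv K q_gt0 kap_s s_kap) /walk_boundary.
rewrite -esum_sum; last by move=> a v _ _; rewrite lee_fin mulr_ge0.
transitivity (\esum_(v in [set: V]) \esum_(a in [set: A])
    (q [::] a * ((v \notin K)%:R * (s a v \in K)%:R))%:E)%E.
  apply: eq_esum => v _; rewrite EFinM -escapeE -esumZl//; last first.
    by move=> a _; rewrite lee_fin mulr_ge0.
  by apply: eq_esum => a _; rewrite -EFinM mulrCA eqb_id.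
rewrite exchange_esum; last first.
  by move=> v a; rewrite lee_fin mulr_ge0// mulr_ge0.
apply: eq_esum => a _.
have kap_bij : bijective (kap a) by exists (s a).
under eq_esum do rewrite EFinM.
rewrite esumZl//.
rewrite -(esum_bij (fun v => ((v \notin K)%:R * (s a v \in K)%:R)%:E) kap_bij).
under eq_esum do rewrite s_kap mulrC.
rewrite esum_in_fset//.
by rewrite -EFinM mulr_sumr sumEFin.
Qed.

Lemma deviation_folner : (forall eps : R, 0 < eps ->
     exists2 K : {fset V}, K != fset0 &
       (\int[m]_z (deviation K z)%:E <= eps%:E * mV R V [set` K])%E) <->
  folner mu s.
Proof.
have eC0 := expR_gt0 C.
split => [dev eps eps0|fol eps eps0].
  have [K K0 KB] := dev (eps / expR C) (divr_gt0 eps0 eC0).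
  exists K => //; rewrite -esum_escape_in.
  rewrite -(integral_vertices mu); last by move=> v; rewrite mulr_ge0 ?escape_ge0.
  apply: (@le_trans _ _ (\int[m]_z ((expR C)%:E * (deviation K z)%:E))%E).
    apply: ae_ge0_le_integral => //.
    - by move=> z _; rewrite lee_fin mulr_ge0 ?escape_ge0.
    - apply/measurable_EFinP; apply: measurable_sections => v /=.
      exact: measurable_cst.
    - apply: measurable_funeM; apply/measurable_EFinP.
      exact: measurable_deviation.
    - apply: ae_sections; apply: filterS ae_regular => x reg v _.
      rewrite -EFinM lee_fin /=.
      have [_] := deviation_bounds K v reg.
      by case: (v \in K) => //= h; rewrite ?mul1r// mul0r mulr_ge0// ltW.
  have -> : (\int[m]_z ((expR C)%:E * (deviation K z)%:E) =
      (expR C)%:E * \int[m]_z (deviation K z)%:E)%E.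
    apply: ge0_integralZl => //.
    by apply/measurable_EFinP; exact: measurable_deviation.
  apply: le_trans (lee_wpmul2l _ KB) _; first by rewrite lee_fin ltW.
  by rewrite mV_fset -!EFinM lee_fin mulrA mulrCA divff ?mulr1// gt_eqF.
(* The factor 2 accounts for mass leaving and mass entering [K], the exponential for the
   distortion. *)
have e2C : 0 < eps / (2 * expR C) by rewrite divr_gt0// mulr_gt0.
have [K K0 KB] := fol _ e2C.
exists K => //.
pose H v := expR C *
  ((v \in K)%:R * escape K false v + (v \notin K)%:R * escape K true v).
have H0 v : 0 <= H v.
  by rewrite /H mulr_ge0 ?expR_ge0// addr_ge0// mulr_ge0// escape_ge0.
apply: (@le_trans _ _ (\int[m]_z (H z.2)%:E)%E).
  apply: ae_ge0_le_integral => //.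
  - by apply/measurable_EFinP; exact: measurable_deviation.
  - by move=> z _; rewrite lee_fin.
  - apply/measurable_EFinP; apply: measurable_sections => v /=.
    exact: measurable_cst.
  - apply: ae_sections; apply: filterS ae_regular => x reg v _.
    rewrite lee_fin /H /=; have [+ _] := deviation_bounds K v reg.
    by case: (v \in K) => /=; rewrite ?mul1r ?mul0r ?addr0 ?add0r.
rewrite integral_vertices//.
under eq_esum do rewrite EFinM EFinD.
rewrite esumZl ?expR_ge0//; last first.
  by move=> v _; rewrite adde_ge0// lee_fin mulr_ge0// escape_ge0.
rewrite esumD; last 2 first.
- by move=> v _; rewrite lee_fin mulr_ge0// escape_ge0.
- by move=> v _; rewrite lee_fin mulr_ge0// escape_ge0.
rewrite esum_escape_in esum_escape_out mV_fset.
apply: le_trans (lee_wpmul2l _ (leeD KB KB)) _; first by rewrite lee_fin ltW.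
rewrite -EFinD -!EFinM lee_fin.
by rewrite le_eqVlt; apply/orP; left; apply/eqP; field; rewrite gt_eqF.
Qed.

End almost_invariant.

(** * Equivalence of the three conditions *)

Lemma regular_le (R : realType) (A : pcountType) (mu : probability (seq_space A) R)
    (C C' r : R) x : 0 <= r -> C <= C' -> (forall w, 0 < mass mu w) ->
  regular mu C r x -> regular mu C' r x.
Proof.
move=> r0 CC' mass0 reg a k; have [b0 b1 b2] := reg a k.
have e : expR (C * r ^+ k) <= expR (C' * r ^+ k).
  by rewrite ler_expR ler_wpM2r// exprn_ge0.
split => //.
- by apply: le_trans b1 _; rewrite ler_wpM2r// ltW// letter_weight_gt0.
- by apply: le_trans b2 _; rewrite ler_wpM2r// ltW.
Qed.

Theorem theoremA (R : realType) (A V : pcountType)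
    (mu : probability (seq_space A) R)
    (E : set (V * V)) (kappa : seq_space A -> V -> V)
    (mu_inv : theta_invariant mu)
    (mu_holder : log_holder mu)
    (kappa_bij : forall x, bijective (kappa x))
    (kappa_fst : forall x y : seq_space A, x 0%N = y 0%N -> kappa x = kappa y)
    (kappa_edge : forall x v, E (v, kappa x v))
    (T_trans : topologically_transitive mu kappa)
    (T_loops : uniform_loops kappa) :
  (mu_amenable mu kappa E <-> spectral_radius mu (transfer mu kappa) = 1%E)
  /\
  (spectral_radius mu (transfer mu kappa) = 1%E <->
   forall eps : R, 0 < eps ->
     exists2 K : {fset V}, K != fset0 &
       (\int[mu \x mV R V]_z
          `| transfer mu kappa \1_([set: seq_space A] `*` [set` K]) z
             - \1_([set: seq_space A] `*` [set` K]) z |%:E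
        <= eps%:E * mV R V [set` K])%E).
Proof.
have mass0 := mass_gt0 mu_holder.
have [C0 [r [C00 r01 reg0]]] := exists_regular mu_holder.
have [r0 r1] := andP r01.
(* This is the constant of [letter_weight_holder]; the regularity bounds only weaken when it
   replaces [C0]. *)
pose C := 4 * C0.
have C_gt0 : 0 < C by rewrite mulr_gt0.
have ae_reg : \forall x \ae mu, regular mu C r x.
  apply: filterS reg0 => x; apply: regular_le => //; first exact: ltW.
  by rewrite /C; lra.
have q_holder := letter_weight_holder mu_holder C00 r01 reg0.
(* A letter is represented by its constant sequence, since [kappa] depends on the first coordinate
   only. *)
have /choice[s sP] : forall a : A, exists g : V -> V,
    cancel (kappa (fun=> a)) g /\ cancel g (kappa (fun=> a)).
  by move=> a; have [g kg gk] := kappa_bij (fun=> a); exists g.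
have kappaE x : kappa x = kappa (fun=> x 0%N) by exact: kappa_fst.
have kappa_s x v : kappa x (s (x 0%N) v) = v.
  by rewrite kappaE; case: (sP (x 0%N)) => _; exact.
have s_kappa (x : seq_space A) v : s (x 0%N) (kappa x v) = v.
  by rewrite kappaE; case: (sP (x 0%N)) => + _; exact.
have [J finJ JP] := T_loops.
pose J0 := [fset (x : seq_space A) 0%N | x in fset_set J]%fset.
have loops v : exists2 a, a \in J0 & s a v = v.
  have [x Jx xv] := JP v; exists (x 0%N).
    by apply: in_imfset; rewrite /= in_fset_set// mem_set.
  (* A vertex fixed by a bijection is fixed by its inverse, so the loops survive the passage to
     [s]. *)
  by rewrite -[in LHS]xv s_kappa.
have rad := spectral_radius_folner mu_inv mu_holder kappa_s s_kappa C_gt0 r01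
  ae_reg q_holder loops.
have dev := deviation_folner mu_inv mu_holder kappa_s s_kappa C_gt0 r01 ae_reg.
have am := amenable_folner mu_inv mass0 kappa_fst kappa_edge.
have kap_s : folner mu (fun a => kappa (fun=> a)) <-> folner mu s.
  have bd K : walk_boundary (letter_weight mu) (fun a => kappa (fun=> a)) K =
      walk_boundary (letter_weight mu) s K.
    apply: walk_boundary_inv => [u a|a|a]; last 2 first.
    - by case: (sP a).
    - by case: (sP a).
    exact: letter_weight_gt0.
  by split => fol eps /fol[K K0 KB]; exists K => //; rewrite ?bd// -bd.
split; first by rewrite am kap_s rad.
by rewrite rad -dev.
Qed.
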